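(* Let $\Phi:G_\infty\to\mathrm{Aut}_*(H)$ be as defined in the context. Then $\Phi$ is a bijection; equip $G_\infty$ with the group structure transported along $\Phi$. For $(\alpha,r)\in(k^\times)^{\mathbb{Z}}\rtimes\mathbb{Z}$ and $(\beta^{(i)})_{i\geq1}\in G_\infty$ put $(\alpha,r)\cdot(\beta^{(i)})_{i\ge1}=\big((\alpha^{-1})\langle i\rangle\,\beta^{(i)}[-r]\big)_{i\geq1}$. This is an action of $(k^\times)^{\mathbb{Z}}\rtimes\mathbb{Z}$ on $G_\infty$ by group automorphisms, and the maps $$G_\infty\rtimes\big((k^\times)^{\mathbb{Z}}\rtimes\mathbb{Z}\big)\to\mathrm{Aut}_c(H),\ (g,(\alpha,r))\mapsto\Phi(g)\phi_\alpha\theta_r,\qquad G_\infty\rtimes(k^\times)^{\mathbb{Z}}\to\mathrm{Aut}_0(H),\ (g,\alpha)\mapsto\Phi(g)\phi_\alpha$$ are group isomorphisms (where $(k^\times)^{\mathbb{Z}}$ acts on $G_\infty$ via its embedding $\alpha\mapsto(\alpha,0)$).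
   Context: Let $k$ be a field and $0\neq q\in k$ not a root of unity. $H=k_q[x,x^{-1},y]$ is the $k$-algebra generated by $x,x^{-1},y$ with $xx^{-1}=x^{-1}x=1$, $yx=qxy$, a Hopf algebra with $\Delta(x)=x\otimes x$, $\Delta(y)=y\otimes x+1\otimes y$, $\varepsilon(x)=1$, $\varepsilon(y)=0$; $\{x^ny^m:n\in\mathbb{Z},m\in\mathbb{N}\}$ is a $k$-basis. $\mathrm{Aut}_c(H)$ is the group under composition of coalgebra automorphisms of $H$, $\mathrm{Aut}_0(H)=\{\phi\in\mathrm{Aut}_c(H):\phi(1)=1\}$, and $\mathrm{Aut}_*(H)$ is the set of $\phi\in\mathrm{Aut}_0(H)$ such that for each $n$ there is $\beta_n\in k$ with $\phi(x^ny)=x^ny+\beta_n(x^{n+1}-x^n)$. Sequences: $k^{\mathbb{Z}}$ and $(k^\times)^{\mathbb{Z}}$ with componentwise operations; for a sequence $\alpha$ and $r\in\mathbb{Z}$, $\alpha[r]_n=\alpha_{n+r}$; $\alpha^{-1}=(\alpha_n^{-1})_n$; $\alpha\langle1\rangle=\alpha$, $\alpha\langle i\rangle=\alpha\,\alpha[1]\cdots\alpha[i-1]$ (componentwise product). $\theta_r$ is the linear map $x^ny^m\mapsto x^{n+r}y^m$; for $\alpha\in(k^\times)^{\mathbb{Z}}$, $\phi_\alpha$ is the linear map with $\phi_\alpha(x^n)=x^n$, $\phi_\alpha(x^ny^m)=(\prod_{i=0}^{m-1}\alpha_{n+i})x^ny^m$ for $m\ge1$. $(k^\times)^{\mathbb{Z}}\rtimes\mathbb{Z}$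 is the set of pairs $(\alpha,r)$ with $(\alpha,r)(\beta,t)=(\alpha\,\beta[-r],r+t)$. For a group $K$ acting on a group $G$ by automorphisms, $G\rtimes K$ has multiplication $(g,\kappa)(g',\kappa')=(g(\kappa\cdot g'),\kappa\kappa')$. Notation: $(n)_q=1+\dots+q^{n-1}$, $(n)!_q=(n)_q\cdots(1)_q$, $\binom{m}{i}_q=\frac{(m)!_q}{(i)!_q(m-i)!_q}$, $(m,j)_q=\prod_{i=0}^{j-1}(m-i)_q$ ($(m,0)_q=1$), $\binom{m}{s}_{q,i}=\prod_{j=0}^{i-1}\binom{m-js}{s}_q$; for $\beta\in k^{\mathbb{Z}}$, $\beta_{n,0}=1$, $\beta_{n,j}=\prod_{i=0}^{j-1}\beta_{n+i}$, $\beta_{n,s;0}=1$, $\beta_{n,s;j}=\prod_{i=0}^{j-1}\beta_{n+is}$. For $\beta\in k^{\mathbb{Z}}$, $\phi^{(1)}_\beta$ is the linear map with $\phi^{(1)}_\beta(x^ny^m)=x^ny^m+\sum_{l=0}^{m-1}(m,m-l)_q(\beta_{n,m-l}x^{n+m-l}-\beta_{n,m-l-1}\beta_{n+m-1}x^{n+m-l-1})y^l$; for $s\ge2$, $\phi^{(s)}_\beta(x^ny^m)=x^ny^m$ for $m<s$ and $\phi^{(s)}_\beta(x^ny^m)=x^ny^m+\sum_{1\le i\le\lfloor m/s\rfloor}\binom{m}{s}_{q,i}(\beta_{n,s;i}x^{n+is}-\beta_{n,s;i-1}\beta_{n+m-s}x^{n+is-s})y^{m-is}$ for $m\ge s$.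 $G_\infty$ is the set of sequences $(\beta^{(1)},\beta^{(2)},\dots)$ with $\beta^{(i)}\in k^{\mathbb{Z}}$, and $\Phi(\beta^{(1)},\beta^{(2)},\dots)$ is the linear map $\phi$ with $\phi(x^n)=x^n$ and $\phi(x^ny^m)=\phi^{(1)}_{\beta^{(1)}}\circ\cdots\circ\phi^{(m)}_{\beta^{(m)}}(x^ny^m)$ for $m\ge1$. *)

(* Defs.v *)
From mathcomp Require Import all_boot all_algebra.
From mathcomp Require Import finmap monalg.
Set Implicit Arguments. Unset Strict Implicit. Unset Printing Implicit Defensive.
Import GRing.Theory.
Local Open Scope ring_scope.

(* Index set of the basis {x^n y^m : n in Z, m in N} of H. *)
Definition Bas := (int * nat)%type.

(* H = k_q[x,x^-1,y] as a k-vector space: finitely supported functions Bas -> k,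
   the element <<(n,m)>> being the basis vector x^n y^m. *)
Notation Hsp k := {malg k[Bas]}.
(* H (x) H: finitely supported functions on Bas * Bas; <<(a,b)>> is e_a (x) e_b. *)
Notation HHsp k := {malg k[(Bas * Bas)%type]}.

Definition mon (k : fieldType) (n : int) (m : nat) : Hsp k := << (n, m) >>.

Arguments mon k n m : clear implicits.

Definition lin_ext (k : fieldType) (f : Bas -> Hsp k) (v : Hsp k) : Hsp k :=
  \sum_(b <- msupp v) v@_b *: f b.

(* multiplication of H (x) H as the tensor product algebra of H with itself,
   where in H: x^a y^b * x^c y^d = q^(b c) x^(a+c) y^(b+d)   (from yx = qxy) *)
Definition mulHH (k : fieldType) (q : k) (t s : HHsp k) : HHsp k :=
  \sum_(a <- msupp t) \sum_(b <- msupp s)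
    << t@_a * s@_b * q ^ (a.1.2%:Z * b.1.1) * q ^ (a.2.2%:Z * b.2.1)
       *g ((a.1.1 + b.1.1, (a.1.2 + b.1.2)%N), (a.2.1 + b.2.1, (a.2.2 + b.2.2)%N)) >>.

Definition Dy (k : fieldType) : HHsp k :=
  << ((0%Z, 1%N), (1%Z, 0%N)) >> + << ((0%Z, 0%N), (0%Z, 1%N)) >>.

(* Delta(x^n y^m) = Delta(x)^n Delta(y)^m = (x^n (x) x^n) * Delta(y)^m,
   Delta being the algebra map with Delta(x) = x (x) x, Delta(y) = y (x) x + 1 (x) y *)
Definition DeltaB (k : fieldType) (q : k) (b : Bas) : HHsp k :=
  iter b.2 (fun t => mulHH q t (Dy k)) << ((b.1, 0%N), (b.1, 0%N)) >>.

Definition Delta (k : fieldType) (q : k) (v : Hsp k) : HHsp k :=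
  \sum_(b <- msupp v) v@_b *: DeltaB q b.

(* counit: eps(x^n y^m) = eps(x)^n eps(y)^m *)
Definition epsB (k : fieldType) (b : Bas) : k := if b.2 == 0%N then 1 else 0.
Definition eps (k : fieldType) (v : Hsp k) : k := \sum_(b <- msupp v) v@_b * epsB k b.

Definition tens (k : fieldType) (u v : Hsp k) : HHsp k :=
  \sum_(a <- msupp u) \sum_(b <- msupp v) << u@_a * v@_b *g (a, b) >>.

Definition tmap (k : fieldType) (f g : Hsp k -> Hsp k) (t : HHsp k) : HHsp k :=
  \sum_(p <- msupp t) t@_p *: tens (f << p.1 >>) (g << p.2 >>).

Definition is_coalg_aut (k : fieldType) (q : k) (phi : Hsp k -> Hsp k) : Prop :=
  [/\ linear phi, bijective phi,
      (forall v, Delta q (phi v) = tmap phi phi (Delta q v))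
    & (forall v, eps (phi v) = eps v)].

Definition is_aut0 (k : fieldType) (q : k) (phi : Hsp k -> Hsp k) : Prop :=
  is_coalg_aut q phi /\ phi (mon k 0 0) = mon k 0 0.

Definition is_aut_star (k : fieldType) (q : k) (phi : Hsp k -> Hsp k) : Prop :=
  is_aut0 q phi /\
  forall n : int, exists beta : k,
    phi (mon k n 1) = mon k n 1 + beta *: (mon k (n + 1) 0 - mon k n 0).

Definition qnum (k : fieldType) (q : k) (n : nat) : k := \sum_(j < n) q ^+ j.
Definition qfact (k : fieldType) (q : k) (n : nat) : k := \prod_(i < n) qnum q i.+1.
Definition qbinom (k : fieldType) (q : k) (m i : nat) : k :=
  qfact q m / (qfact q i * qfact q (m - i)).
Definition qfall (k : fieldType) (q : k) (m j : nat) : k := \prod_(i < j) qnum q (m - i).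
Definition qbinom_it (k : fieldType) (q : k) (m s i : nat) : k :=
  \prod_(j < i) qbinom q (m - j * s) s.

Definition bprod (k : fieldType) (beta : int -> k) (n : int) (j : nat) : k :=
  \prod_(i < j) beta (n + i%:Z).
Definition bprod_s (k : fieldType) (beta : int -> k) (n : int) (s j : nat) : k :=
  \prod_(i < j) beta (n + (i * s)%N%:Z).

Definition phi1B (k : fieldType) (q : k) (beta : int -> k) (b : Bas) : Hsp k :=
  let n := b.1 in let m := b.2 in
  mon k n m +
  \sum_(l < m) qfall q m (m - l) *:
     (bprod beta n (m - l) *: mon k (n + (m - l)%N%:Z) l
      - (bprod beta n (m - l - 1) * beta (n + m%:Z - 1)) *: mon k (n + (m - l)%N%:Z - 1) l).

Definition phisB (k : fieldType) (q : k) (s : nat) (beta : int -> k) (b : Bas) : Hsp k :=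
  let n := b.1 in let m := b.2 in
  if s == 1%N then phi1B q beta b
  else if (m < s)%N then mon k n m
  else mon k n m +
    \sum_(1 <= i < (m %/ s).+1) qbinom_it q m s i *:
      (bprod_s beta n s i *: mon k (n + (i * s)%N%:Z) (m - i * s)
       - (bprod_s beta n s i.-1 * beta (n + m%:Z - s%:Z))
           *: mon k (n + (i * s)%N%:Z - s%:Z) (m - i * s)).

(* G_infty: g i is beta^{(i+1)} (0-based indexing of the sequence beta^{(1)}, beta^{(2)}, ...) *)
Definition Ginf (k : fieldType) := (nat -> int -> k)%type.

Definition Phi (k : fieldType) (q : k) (g : Ginf k) : Hsp k -> Hsp k :=
  lin_ext (fun b =>
    foldr (fun s acc => lin_ext (phisB q s (g s.-1)) \o acc) id (iota 1 b.2) (mon k b.1 b.2)).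

Definition phi_alpha (k : fieldType) (alpha : int -> k) : Hsp k -> Hsp k :=
  lin_ext (fun b => (\prod_(i < b.2) alpha (b.1 + i%:Z)) *: mon k b.1 b.2).

Definition theta (k : fieldType) (r : int) : Hsp k -> Hsp k :=
  lin_ext (fun b => mon k (b.1 + r) b.2).

Arguments theta k r : clear implicits.

Definition unit_seq (k : fieldType) (alpha : int -> k) : Prop := forall n, alpha n != 0.

Definition sd_mul (k : fieldType) (a b : (int -> k) * int) : (int -> k) * int :=
  (fun n => a.1 n * b.1 (n - a.2), a.2 + b.2).

(* (alpha, r) . (beta^{(i)})_i = ((alpha^{-1})<i> beta^{(i)}[-r])_i   (0-based: i.+1) *)
Definition act (k : fieldType) (a : (int -> k) * int) (g : Ginf k) : Ginf k :=
  fun i n => (\prod_(j < i.+1) (a.1 (n + j%:Z))^-1) * g i (n - a.2).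

Definition Psi (k : fieldType) (q : k) (g : Ginf k) (a : (int -> k) * int) : Hsp k -> Hsp k :=
  Phi q g \o phi_alpha a.1 \o theta k a.2.

Definition Psi0 (k : fieldType) (q : k) (g : Ginf k) (alpha : int -> k) : Hsp k -> Hsp k :=
  Phi q g \o phi_alpha alpha.

(* Main.v *)
(* In the basis x^n y^m / (m)!_q the coproduct is that of the path coalgebra of the quiver
   ... -> n -> n+1 -> ..., so the dual of H is the algebra of upper triangular Z x Z matrices,
   and coalgebra maps of H transpose to algebra maps. Under transposition phi^(s)_beta becomes
   conjugation by 1 - D_s, where D_s has the single nonzero diagonal beta / (s)!_q in degree s,
   so Phi(g) becomes A |-> W^-1 A W with W = (1 - D_1)(1 - D_2)(1 - D_3)...; every
   unitriangular matrix is such a product for exactly one g. The map phi_alpha theta_r becomes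
   a diagonal rescaling composed with a translation.
   Conversely a coalgebra automorphism permutes the group-likes x^n, and skew-primitives force
   this permutation to be a translation. After undoing it, the diagonal idempotents E_n go to
   idempotents F_n, and conjugation by the unitriangular matrix sum_n E_n F_n takes F_n back to
   E_n; an automorphism fixing every E_n is a diagonal rescaling. *)

Require Import Defs.
From HB Require Import structures.
From mathcomp Require Import all_boot all_algebra.
From mathcomp Require Import finmap monalg zify ring.
From Stdlib Require Import FunctionalExtensionality.
Import GRing.Theory.
Local Open Scope ring_scope.

(** The change of variables behind associativity of convolution. *)
Lemma triangle_sum (V : nmodType) (F : nat -> nat -> V) (M : nat) :
  \sum_(l < M) \sum_(i < l.+1) F i (l - i)%N =
  \sum_(i < M) \sum_(j < (M - i)%N) F i j.
Proof.
elim: M => [|M IH]; first by rewrite !big_ord0.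
rewrite big_ord_recr /= IH.
under [RHS]eq_bigr => i _ do
  rewrite (subSn (ltn_ord i : (i <= M)%N)) big_ord_recr /=.
rewrite big_split /=; congr (_ + _).
by rewrite [RHS]big_ord_recr /= subnn big_ord0 addr0.
Qed.

(** * The incidence algebra of the ordered set of integers *)

(* [A n m] is the entry of an upper triangular [Z x Z] matrix at position [(n, n + m)]. *)
Section Incidence.
Set Implicit Arguments.
Unset Strict Implicit.
Variable k : fieldType.
Implicit Types A B C : int -> nat -> k.

(** The intermediate index [n + i] runs over the finite interval from [n] to [n + m], so products of
    infinite matrices are finite sums entrywise. *)
Definition imul A B : int -> nat -> k :=
  fun n m => \sum_(i < m.+1) A n i * B (n + i%:Z) (m - i)%N.
Definition ione : int -> nat -> k := fun _ m => (m == 0)%:R.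

Local Infix "**" := imul (at level 40, left associativity).

Lemma inc_ext A B : (forall n m, A n m = B n m) -> A = B.
Proof.
by move=> AB; do 2![apply: functional_extensionality => ?]; apply: AB.
Qed.

Lemma imulA A B C : A ** (B ** C) = A ** B ** C.
Proof.
apply: inc_ext => n m; rewrite /imul.
pose F i j := A n i * B (n + i%:Z) j * C (n + i%:Z + j%:Z) (m - i - j)%N.
transitivity (\sum_(i < m.+1) \sum_(j < (m.+1 - i)%N) F i j).
  apply: eq_bigr => i _.
  by rewrite mulr_sumr (subSn (ltn_ord i : (i <= m)%N));
     apply: eq_bigr => j _; rewrite mulrA.
rewrite -triangle_sum; apply: eq_bigr => l _.
rewrite mulr_suml; apply: eq_bigr => i _; rewrite /F.
by congr (_ * C _ _); case: i => i /=; lia.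
Qed.

Lemma imul1 A : ione ** A = A.
Proof.
apply: inc_ext => n m; rewrite /imul big_ord_recl /= mul1r addr0 subn0.
by rewrite big1 ?addr0 // => i _; rewrite mul0r.
Qed.

Lemma imulr1 A : A ** ione = A.
Proof.
apply: inc_ext => n m; rewrite /imul big_ord_recr /= subnn mulr1.
rewrite big1 ?add0r // => i _; rewrite /ione.
by rewrite (_ : (m - i == 0)%N = false) ?mulr0 //; case: i => i /=; lia.
Qed.

(** * Convergence degree by degree *)

Definition iagree d A B := forall n m, (m < d)%N -> A n m = B n m.

Lemma iagree_imul d A A' B B' :
  iagree d A A' -> iagree d B B' -> iagree d (A ** B) (A' ** B').
Proof.
move=> AA BB n m lt_m; apply: eq_bigr => i _.
by rewrite AA ?BB //; case: i => i /=; lia.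
Qed.

Definition unitri A := forall n, A n 0%N = 1.

Lemma unitri_mul A B : unitri A -> unitri B -> unitri (A ** B).
Proof. by move=> A1 B1 n; rewrite /imul big_ord1 A1 addr0 B1 mulr1. Qed.

Lemma iagree_ext A B : (forall t, iagree t.+1 A B) -> A = B.
Proof. by move=> AB; apply: inc_ext => n m; apply: (AB m). Qed.

Lemma iagree_trans d A B C : iagree d A B -> iagree d B C -> iagree d A C.
Proof. by move=> AB BC n m lt_m; rewrite AB ?BC. Qed.

Lemma iagree_sym d A B : iagree d A B -> iagree d B A.
Proof. by move=> AB n m lt_m; rewrite AB. Qed.

(** Degree [m] is read off at stage [m], after which it is constant once [X t] and [X t.+1] agree up
    to degree [t]. *)
Definition ilim (X : nat -> int -> nat -> k) : int -> nat -> k :=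
  fun n m => X m n m.

Lemma iagree_ilim (X : nat -> int -> nat -> k) :
  (forall t, iagree t.+1 (X t) (X t.+1)) ->
  forall t, iagree t.+1 (ilim X) (X t).
Proof.
move=> stepX t n m lt_m; rewrite /ilim -(subnKC (lt_m : (m <= t)%N)).
elim: (t - m)%N => [|d IH].
  by rewrite addn0.
by rewrite IH addnS; apply: stepX; lia.
Qed.

(** A right inverse solves X = 1 - (A - 1) X. As A - 1 vanishes in degree 0, the right-hand side
    gains one degree of agreement, and iteration from [ione] converges. *)
Lemma iinv_ex A : unitri A -> exists2 B, unitri B & A ** B = ione.
Proof.
move=> A1.
pose T X n m := ione n m - \sum_(i < m) A n i.+1 * X (n + i.+1%:Z) (m - i.+1)%N.
have T_contract d X Y : iagree d X Y -> iagree d.+1 (T X) (T Y).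
  move=> XY n m lt_m; congr (_ - _); apply: eq_bigr => i _.
  by rewrite XY //; case: i => i /=; lia.
have stepT t : iagree t.+1 (iter t T ione) (iter t.+1 T ione).
  elim: t => [|t IH]; last exact: T_contract.
  by move=> n [|m] // _; rewrite /= /T big_ord0 subr0.
have limT := iagree_ilim stepT; set B := ilim _ in limT.
exists B => //; apply: iagree_ext => t n m lt_m.
have -> : (A ** B) n m = B n m + \sum_(i < m) A n i.+1 * B (n + i.+1%:Z) (m - i.+1)%N.
  by rewrite /imul big_ord_recl A1 mul1r addr0 subn0.
rewrite (limT t.+1) 1?ltnW //= {1}/T.
rewrite (eq_bigr (fun i : 'I_m => A n i.+1 * B (n + i.+1%:Z) (m - i.+1)%N)) ?subrK //.
by move=> i _; rewrite (limT t) //; case: i => i /=; lia.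
Qed.

(** If B is a right inverse of A and C one of B, then A = A (B C) = (A B) C = C. *)
Lemma iinvP A : unitri A -> exists B, [/\ unitri B, A ** B = ione & B ** A = ione].
Proof.
move=> /iinv_ex[B B1 AB]; have [C _ BC] := iinv_ex B1; exists B; split=> //.
by rewrite (_ : A = C) // -[A]imulr1 -BC imulA AB imul1.
Qed.

(** * Infinite products of factors 1 - D_t *)

Definition ifac B t : int -> nat -> k :=
  fun n m => ione n m - (m == t)%:R * B n t.

Lemma imul_ifac A B t n m : (A ** ifac B t.+1) n m =
  A n m - if (t < m)%N then A n (m - t.+1)%N * B (n + (m - t.+1)%N%:Z) t.+1 else 0.
Proof.
have -> : (A ** ifac B t.+1) n m = (A ** ione) n m -
    \sum_(i < m.+1) (m - i == t.+1)%N%:R * (A n i * B (n + i%:Z) t.+1).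
  by rewrite /imul -sumrB; apply: eq_bigr => i _; rewrite mulrBr mulrCA.
rewrite imulr1; congr (_ - _); case: ifP => lt_tm.
  have lt_i : (m - t.+1 < m.+1)%N by lia.
  rewrite (bigD1 (Ordinal lt_i)) //= subKn // eqxx mul1r big1 ?addr0 //.
  move=> i neq_i; case: eqP => [eq_i|]; last by rewrite mul0r.
  by case/eqP: neq_i; apply: val_inj => /=; case: i eq_i => i /=; lia.
rewrite big1 // => i _; case: eqP => [|_]; last by rewrite mul0r.
by case: i => i /=; lia.
Qed.

Lemma ifac_imul A B t n m : (ifac B t.+1 ** A) n m =
  A n m - if (t < m)%N then B n t.+1 * A (n + t.+1%:Z) (m - t.+1)%N else 0.
Proof.
have -> : (ifac B t.+1 ** A) n m = (ione ** A) n m -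
    \sum_(i < m.+1) (i == t.+1 :> nat)%:R * (B n t.+1 * A (n + i%:Z) (m - i)%N).
  by rewrite /imul -sumrB; apply: eq_bigr => i _; rewrite mulrBl mulrA.
rewrite imul1; congr (_ - _); case: ifP => lt_tm.
  have lt_i : (t.+1 < m.+1)%N by lia.
  rewrite (bigD1 (Ordinal lt_i)) //= eqxx mul1r big1 ?addr0 //.
  move=> i neq_i; case: eqP => [eq_i|]; last by rewrite mul0r.
  by case/eqP: neq_i; apply: val_inj.
rewrite big1 // => i _; case: eqP => [|_]; last by rewrite mul0r.
by case: i => i /=; lia.
Qed.

Lemma iagree_ifac B t : iagree t (ifac B t) ione.
Proof. by move=> n m lt_m; rewrite /ifac ltn_eqF // mul0r subr0. Qed.

Fixpoint wseq B t : int -> nat -> k :=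
  if t is t'.+1 then wseq B t' ** ifac B t'.+1 else ione.

(** The infinite product (1 - D_1)(1 - D_2)..., with D_t the diagonal of [B] in degree [t]; the
    factor 1 - D_t is trivial below degree [t], so the partial products stabilise. *)
Definition wprod B := ilim (wseq B).

Lemma wseq_step B t : iagree t.+1 (wseq B t) (wseq B t.+1).
Proof.
rewrite /= -{1}[wseq B t]imulr1; apply: iagree_imul => //.
exact/iagree_sym/iagree_ifac.
Qed.

Lemma iagree_wprod B t : iagree t.+1 (wprod B) (wseq B t).
Proof. exact: iagree_ilim (wseq_step B) t. Qed.

Lemma unitri_wseq B t : unitri (wseq B t).
Proof.
elim: t => // t IH; apply: unitri_mul => // n.
by rewrite /ifac mul0r subr0.
Qed.

Lemma unitri_wprod B : unitri (wprod B).
Proof. exact: (unitri_wseq B 0). Qed.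

Lemma eq_wseq B B' t : iagree t.+1 B B' -> wseq B t = wseq B' t.
Proof.
elim: t => //= t IH BB; rewrite IH => [|n m /ltnW]; last exact: BB.
by congr (_ ** _); apply: inc_ext => n m; rewrite /ifac BB.
Qed.

(** Later factors do not reach degree [m.+1], and the unit diagonal of the partial product makes the
    last factor contribute exactly [- B n m.+1]. So [B] can be solved for one degree at a time. *)
Lemma wprodS B n m : wprod B n m.+1 = wseq B m n m.+1 - B n m.+1.
Proof.
by rewrite /wprod /ilim /= imul_ifac ltnSn subnn (unitri_wseq B m) mul1r addr0.
Qed.

(* Degree 0 of [B] plays no role in [wprod B]. *)
Lemma eq_wprod B B' : (forall n m, B n m.+1 = B' n m.+1) -> wprod B = wprod B'.
Proof.
move=> BB; suff eqw t : wseq B t = wseq B' t.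
  by apply: inc_ext => n m; rewrite /wprod /ilim eqw.
elim: t => //= t ->; congr (_ ** _); apply: inc_ext => n m.
by rewrite /ifac BB.
Qed.

Lemma wprod_inj B B' : wprod B = wprod B' -> forall n m, B n m.+1 = B' n m.+1.
Proof.
(* Degree 0 is normalised to 0, which starts the induction. *)
pose C (D : int -> nat -> k) n m := if m is 0 then 0 else D n m.
have wC D : wprod (C D) = wprod D by apply: eq_wprod.
move=> WW; suff CC t : iagree t.+1 (C B) (C B') by move=> n m; apply: (CC m.+1 n m.+1).
elim: t => [|t IH] n [|m] //; rewrite ltnS leq_eqVlt => /orP[/eqP[->]|]; last exact: IH.
apply/oppr_inj/(addrI (wseq (C B) t n t.+1)).
by rewrite -wprodS (eq_wseq IH) -wprodS !wC WW.
Qed.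

Lemma wprod_surj A : unitri A -> exists B, wprod B = A.
Proof.
move=> A1.
(* Stage [t.+1] adds the diagonal in degree [t.+1], with the value that [wprodS] forces. *)
pose X := fix X t : int -> nat -> k :=
  if t is t'.+1 then fun n m =>
    if m == t'.+1 then wseq (X t') t' n m - A n m else X t' n m
  else fun _ _ => 0.
have stepX t : iagree t.+1 (X t) (X t.+1) by move=> n m lt_m /=; rewrite ltn_eqF.
have limX := iagree_ilim stepX.
exists (ilim X); apply: inc_ext => n [|m]; first by rewrite unitri_wprod A1.
by rewrite wprodS (eq_wseq (limX m)) /ilim /= eqxx subKr.
Qed.

(** By induction [wseq B t ** X t = A ** wseq B t]. This passes to the limit: [X t] and [X t.+1]
    agree up to degree [t], as the factor relating them is 1 there. *)
Lemma wprod_intertwine A B (X : nat -> int -> nat -> k) :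
  X 0%N = A -> (forall t, ifac B t.+1 ** X t.+1 = X t ** ifac B t.+1) ->
  wprod B ** ilim X = A ** wprod B.
Proof.
move=> X0 stepX.
have limX := iagree_ilim (X := X) _.
have WX t : wseq B t ** X t = A ** wseq B t.
  by elim: t => [|t IH] /=; rewrite ?X0 ?imulr1 ?imul1 // -imulA stepX imulA IH imulA.
apply: iagree_ext => t.
have WB := @iagree_wprod B t.
have XX : iagree t.+1 (ilim X) (X t).
  apply: limX => s; rewrite -[X s]imulr1 -[X s.+1]imul1.
  apply: (@iagree_trans _ _ (X s ** ifac B s.+1)).
    by apply: iagree_imul => //; apply/iagree_sym/iagree_ifac.
  by rewrite -stepX; apply: iagree_imul => //; apply: iagree_ifac.
apply: (iagree_trans (iagree_imul WB XX)); rewrite WX.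
by apply: iagree_imul => //; apply/iagree_sym.
Qed.

(** * Rescalings and translations of the incidence algebra *)

Lemma bprodD (al : int -> k) n i j :
  bprod al n (i + j) = bprod al n i * bprod al (n + i%:Z) j.
Proof.
rewrite /bprod big_split_ord /=; congr (_ * _).
by apply: eq_bigr => l _; rewrite PoszD addrA.
Qed.

(** The weight [bprod a.1] is multiplicative along paths, so this rescaling followed by a
    translation is an algebra endomorphism; for nowhere zero [a.1] the rescaling is conjugation by a
    diagonal matrix. *)
Definition itau (a : (int -> k) * int) A : int -> nat -> k :=
  fun n m => bprod a.1 (n + a.2) m * A (n + a.2) m.

Lemma itau_mul a A B : itau a (A ** B) = itau a A ** itau a B.
Proof.
apply: inc_ext => n m; rewrite /itau /imul mulr_sumr; apply: eq_bigr => i _.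
have le_im : (i <= m)%N by case: i.
rewrite -{1}(subnKC le_im) bprodD mulrACA.
by congr (_ * (bprod _ _ _ * B _ _)); rewrite addrAC.
Qed.

Lemma itau_one a : itau a ione = ione.
Proof.
by apply: inc_ext => n [|m]; rewrite /itau /ione ?mulr0 // /bprod big_ord0 mulr1.
Qed.

(** A degree-preserving algebra map sends each factor 1 - D_t to a factor of the same kind. *)
Lemma itau_wprod a B : itau a (wprod B) = wprod (itau a B).
Proof.
suff tauW t : itau a (wseq B t) = wseq (itau a B) t.
  by apply: inc_ext => n m; rewrite /wprod /ilim -tauW.
elim: t => [|t IH] /=; first exact: itau_one.
rewrite itau_mul IH; congr (_ ** _); apply: inc_ext => n m.
have := congr1 (fun A => A n m) (itau_one a); rewrite /itau /ifac mulrBr => ->.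
rewrite mulrCA.
by case: eqP => [->|]; rewrite ?mul0r.
Qed.

End Incidence.

Local Infix "**" := imul (at level 40, left associativity).

(** * Linear maps on free modules *)

Section LinearExtension.
Set Implicit Arguments.
Unset Strict Implicit.
Variables (k : fieldType) (K : choiceType).

(** With an arbitrary target module, [lin_ext], [Delta], [tmap] and [mpair] are all instances up to
    unfolding. *)
Definition mext (V : lmodType k) (F : K -> V) (v : {malg k[K]}) : V :=
  \sum_(b <- msupp v) v@_b *: F b.

Lemma mextEw (V : lmodType k) (F : K -> V) (d : {fset K}) (v : {malg k[K]}) :
  (msupp v `<=` d)%fset -> mext F v = \sum_(b <- d) v@_b *: F b.
Proof.
move=> sub_d; rewrite /mext (big_fset_incl _ sub_d) // => b _ nb.
by rewrite mcoeff_outdom // scale0r.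
Qed.

Lemma mext_linear (V : lmodType k) (F : K -> V) : linear (mext F).
Proof.
move=> a u v; pose d := (msupp u `|` msupp v)%fset.
have du : (msupp u `<=` d)%fset by apply: fsubsetUl.
have dv : (msupp v `<=` d)%fset by apply: fsubsetUr.
have duv : (msupp (a *: u + v) `<=` d)%fset.
  apply: fsubset_trans (msuppD_le _ _) _; rewrite fsubUset dv andbT.
  exact: fsubset_trans (msuppZ_le _ _) du.
rewrite (mextEw _ du) (mextEw _ dv) (mextEw _ duv) scaler_sumr -big_split /=.
by apply: eq_bigr => b _; rewrite mcoeffD mcoeffZ scalerDl scalerA.
Qed.

Lemma mextU (V : lmodType k) (F : K -> V) c b : mext F << c *g b >> = c *: F b.
Proof. by rewrite (mextEw _ msuppU_le) big_seq_fset1 mcoeffUU. Qed.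

Lemma linear_mext (V : lmodType k) (phi : {malg k[K]} -> V) v :
  linear phi -> phi v = mext (fun b => phi << b >>) v.
Proof.
move=> phiL; pose f : {linear {malg k[K]} -> V} :=
  HB.pack phi (GRing.isLinear.Build _ _ _ _ phi phiL).
rewrite -[phi]/(f : _ -> _) {1}(monalgE v) linear_sum; apply: eq_bigr => b _ /=.
rewrite -[phi]/(f : _ -> _) -linearZ; congr (f _); apply/malgP => b'.
by rewrite mcoeffZ !mcoeffU mulrnAr mulr1.
Qed.

Lemma linear_malg_ext (V : lmodType k) (phi psi : {malg k[K]} -> V) :
  linear phi -> linear psi -> (forall b, phi << b >> = psi << b >>) -> phi = psi.
Proof.
move=> phiL psiL eq_b; apply: functional_extensionality => v.
rewrite (linear_mext _ phiL) (linear_mext _ psiL) /mext.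
by apply: eq_bigr => b _; rewrite eq_b.
Qed.

Lemma linear_comp_fun (U V W : lmodType k) (f : V -> W) (g : U -> V) :
  linear f -> linear g -> linear (f \o g).
Proof. by move=> fL gL a u v; rewrite /= gL fL. Qed.

Lemma linearZ_fun (U V : lmodType k) (f : U -> V) a u :
  linear f -> f (a *: u) = a *: f u.
Proof.
move=> fL; pose g : {linear U -> V} := HB.pack f (GRing.isLinear.Build _ _ _ _ f fL).
by rewrite -[f]/(g : _ -> _) linearZ.
Qed.

(** Arbitrary functions on the basis are allowed: this is the pairing with the full dual. *)
Definition mpair (C : K -> k) (t : {malg k[K]}) : k :=
  \sum_(b <- msupp t) t@_b * C b.

Lemma mpair_linear (C : K -> k) : linear (mpair C : _ -> k^o).
Proof. exact: (mext_linear (C : K -> k^o)). Qed.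

Lemma mpair_delta b t : mpair (fun b' => (b' == b)%:R) t = t@_b.
Proof.
rewrite /mpair -[RHS]/(mcoeff b t) [in RHS](monalgE t) raddf_sum /=.
by apply: eq_bigr => b' _; rewrite mcoeffU mulr_natr.
Qed.

Lemma mpair_inj t t' : (forall C, mpair C t = mpair C t') -> t = t'.
Proof. by move=> tt'; apply/malgP => b; rewrite -!mpair_delta. Qed.

End LinearExtension.

Lemma mpair_mext (k : fieldType) (K K' : choiceType) (F : K' -> {malg k[K]})
    (C : K -> k) t :
  mpair C (mext F t) = mpair (fun b => mpair C (F b)) t.
Proof.
have := linear_mext t
  (linear_comp_fun (mpair_linear C) (mext_linear F)).
by move=> /= ->; apply: eq_bigr => b _; rewrite /= mextU scale1r.
Qed.

(** * Coalgebra maps as algebra maps of the dual *)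

Section Duality.
Set Implicit Arguments.
Unset Strict Implicit.
Variables (k : fieldType) (q : k).
Hypothesis hq : forall n : nat, (0 < n)%N -> q ^+ n != 1.

Lemma scale_malgU (K : choiceType) c x (b : K) :
  c *: (<< x *g b >> : {malg k[K]}) = << c * x *g b >>.
Proof. by apply/malgP => b'; rewrite mcoeffZ !mcoeffU mulrnAr. Qed.

Lemma mpairZ (K : choiceType) (C : K -> k) a t : mpair C (a *: t) = a * mpair C t.
Proof. exact: (linearZ_fun a t (mpair_linear C)). Qed.

Lemma mpairD (K : choiceType) (C : K -> k) t t' :
  mpair C (t + t') = mpair C t + mpair C t'.
Proof. by have := mpair_linear C 1 t t'; rewrite !scale1r. Qed.

Lemma mpairU (K : choiceType) (C : K -> k) x (b : K) : mpair C << x *g b >> = x * C b.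
Proof. exact: (mextU (C : K -> k^o) x b). Qed.

Lemma mpair0 (K : choiceType) (C : K -> k) : mpair C 0 = 0.
Proof. by rewrite -(scale0r 0) mpairZ mul0r. Qed.

Lemma mpair_sum (K : choiceType) (C : K -> k) (I : Type) (r : seq I) (P : pred I) F :
  mpair C (\sum_(i <- r | P i) F i) = \sum_(i <- r | P i) mpair C (F i).
Proof. exact: (big_morph _ (mpairD C) (mpair0 C)). Qed.

Lemma mpairUD (K : choiceType) (C : K -> k) (b b' : K) :
  mpair C (<< b >> + << b' >>) = C b + C b'.
Proof. by rewrite mpairD !mpairU !mul1r. Qed.

Lemma mpairB (K : choiceType) (C : K -> k) t t' :
  mpair C (t - t') = mpair C t - mpair C t'.
Proof. by rewrite mpairD -scaleN1r mpairZ mulN1r. Qed.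

(** * q-factorials and the coproduct formula *)

Lemma qnum_neq0 n : qnum q n.+1 != 0.
Proof.
(* Since q^N - 1 = (q - 1) (N)_q, a vanishing (N)_q would make q a root of unity. *)
apply/eqP => q0; have := subrX1 q n.+1; rewrite -[X in _ * X]/(qnum q n.+1) q0 mulr0.
by move/eqP; rewrite subr_eq0 (negbTE (hq _)).
Qed.

Lemma qfactS n : qfact q n.+1 = qfact q n * qnum q n.+1.
Proof. by rewrite /qfact big_ord_recr. Qed.

Lemma qfact0 : qfact q 0 = 1. Proof. by rewrite /qfact big_ord0. Qed.

Lemma qfact_neq0 n : qfact q n != 0.
Proof.
by elim: n => [|n IH]; rewrite ?qfact0 ?oner_neq0 // qfactS mulf_neq0 ?qnum_neq0.
Qed.

Lemma qnumD i j : qnum q (i + j) = qnum q i * q ^+ j + qnum q j.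
Proof.
rewrite addnC /qnum big_split_ord /= addrC mulr_suml; congr (_ + _).
by apply: eq_bigr => l _; rewrite -exprD addnC.
Qed.

Lemma mulHH_mext (t s : HHsp k) : mulHH q t s =
  mext (fun a => mext (fun b =>
    << q ^ (a.1.2%:Z * b.1.1) * q ^ (a.2.2%:Z * b.2.1)
       *g ((a.1.1 + b.1.1, (a.1.2 + b.1.2)%N), (a.2.1 + b.2.1, (a.2.2 + b.2.2)%N)) >>) s) t.
Proof.
apply: eq_bigr => a _; rewrite scaler_sumr; apply: eq_bigr => b _.
by rewrite !scale_malgU !mulrA.
Qed.

(** The power of [q] arises from moving [x] to the left past the power of [y] in the second tensor
    factor. *)
Lemma mpair_mulDy (C : Bas * Bas -> k) (t : HHsp k) : mpair C (mulHH q t (Dy k)) =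
  mpair (fun a => q ^+ a.2.2 * C ((a.1.1, a.1.2.+1), (a.2.1 + 1, a.2.2))
                  + C (a.1, (a.2.1, a.2.2.+1))) t.
Proof.
rewrite mulHH_mext mpair_mext; apply: eq_bigr => -[[n i] [n' j]] _; congr (_ * _).
rewrite mpair_mext mpairUD /=; congr (_ + _); rewrite mpairU.
  by rewrite mulr0 mulr1 expr0z mul1r addr0 addn0 addn1 -exprnP.
by rewrite !mulr0 !expr0z !mul1r !addr0 !addn0 addn1.
Qed.

(** The q-binomial expansion of Delta(x^n y^m), tested against functionals; the induction step is
    the q-Pascal rule. *)
Lemma mpair_DeltaB (C : Bas * Bas -> k) n m : mpair C (DeltaB q (n, m)) =
  qfact q m * \sum_(i < m.+1)
    C ((n, i : nat), (n + i%:Z, (m - i)%N)) / (qfact q i * qfact q (m - i)).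
Proof.
elim: m C => [|m IH] C.
  by rewrite mpairU big_ord1 /= !qfact0 addr0 mul1r mulr1 invr1 mulr1 mul1r.
pose c i := C ((n, i), (n + i%:Z, (m.+1 - i)%N)) / (qfact q i * qfact q (m.+1 - i)).
rewrite [LHS]/= mpair_mulDy IH qfactS -mulrA; congr (_ * _).
transitivity (\sum_(i < m.+1) (qnum q i.+1 * q ^+ (m - i) * c i.+1 +
                               qnum q (m.+1 - i) * c i)).
  apply: eq_bigr => i _ /=; have le_im : (i <= m)%N by case: i.
  rewrite /c !subSS (subSn le_im) !qfactS.
  have -> : n + i.+1%:Z = n + i%:Z + 1 by lia.
  by field; rewrite !qfact_neq0 !qnum_neq0.
rewrite big_split /= mulr_sumr.
(* Both sums extend to the indices of degree [m.+1]: the added end terms have coefficient (0)_q =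
   0. *)
rewrite (_ : \sum_(i < m.+1) qnum q i.+1 * _ * _ =
  \sum_(i < m.+2) qnum q i * q ^+ (m.+1 - i) * c i); last first.
  by rewrite [RHS]big_ord_recl {2}/qnum big_ord0 !mul0r add0r.
rewrite (_ : \sum_(i < m.+1) qnum q (m.+1 - i) * _ =
  \sum_(i < m.+2) qnum q (m.+1 - i) * c i); last first.
  by rewrite [RHS]big_ord_recr /= subnn {3}/qnum big_ord0 !mul0r addr0.
rewrite -big_split /=; apply: eq_bigr => i _; rewrite -mulrDl -qnumD.
by rewrite subnKC //; case: i.
Qed.

(** The q-factorial makes [A n m] the value on the divided power x^n y^m / (m)!_q. *)
Definition pairing A (v : Hsp k) : k := mpair (fun b => qfact q b.2 * A b.1 b.2) v.

Local Notation pr := pairing.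

(* Transpose of [phi] with respect to the basis of divided powers [x^n y^m / (m)!_q]. *)
Definition transp (phi : Hsp k -> Hsp k) (A : int -> nat -> k) : int -> nat -> k :=
  fun n m => pr A (phi (mon k n m)) / qfact q m.
Local Notation dual := transp.

Lemma pr_mon A n m : pr A (mon k n m) = qfact q m * A n m.
Proof. by rewrite /pairing mpairU mul1r. Qed.

Lemma prE phi A n m : pr A (phi (mon k n m)) = qfact q m * dual phi A n m.
Proof. by rewrite mulrC divfK ?qfact_neq0. Qed.

Lemma pr_dual phi A v : linear phi -> pr A (phi v) = pr (dual phi A) v.
Proof.
move=> phiL; rewrite (linear_mext v phiL) /pairing mpair_mext.
by apply: eq_bigr => -[n m] _; rewrite -[mpair _ _]/(pr A _) prE.
Qed.

Lemma pr_inj v w : (forall A, pr A v = pr A w) -> v = w.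
Proof.
move=> vw; apply: mpair_inj => C; have := vw (fun n m => C (n, m) / qfact q m).
have E u : pr (fun n m => C (n, m) / qfact q m) u = mpair C u.
  by apply: eq_bigr => -[n m] _; congr (_ * _); rewrite mulrC divfK ?qfact_neq0.
by rewrite !E.
Qed.

Lemma dual_inj phi psi : linear phi -> linear psi ->
  (forall A, dual phi A = dual psi A) -> phi = psi.
Proof.
move=> phiL psiL eq_d; apply: functional_extensionality => v.
by apply: pr_inj => A; rewrite !pr_dual // eq_d.
Qed.

Lemma dual_comp phi psi A : linear phi -> dual (phi \o psi) A = dual psi (dual phi A).
Proof. by move=> phiL; apply: inc_ext => n m; rewrite /transp /= pr_dual. Qed.

Lemma dual_id A : dual id A = A.
Proof. by apply: inc_ext => n m; rewrite /transp pr_mon mulrAC mulfV ?mul1r ?qfact_neq0. Qed.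

Definition ftens (C D : Bas -> k) (p : Bas * Bas) : k := C p.1 * D p.2.

Lemma mpair_tens C D (u v : Hsp k) :
  mpair (ftens C D) (tens u v) = mpair C u * mpair D v.
Proof.
have -> : tens u v = mext (fun a => mext (fun b => << (a, b) >>) v) u.
  apply: eq_bigr => a _; rewrite scaler_sumr; apply: eq_bigr => b _.
  by rewrite !scale_malgU mulr1.
rewrite mpair_mext [RHS]mulr_suml; apply: eq_bigr => a _; rewrite -mulrA.
congr (_ * _); rewrite mpair_mext [RHS]mulr_sumr; apply: eq_bigr => b _.
by rewrite mpairU mul1r mulrCA.
Qed.

(** Product functionals include the coordinate functions of the tensor square. *)
Lemma ftens_inj (t t' : HHsp k) :
  (forall C D, mpair (ftens C D) t = mpair (ftens C D) t') -> t = t'.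
Proof.
move=> tt'; apply/malgP => -[a b].
have E u : mpair (ftens (fun a' => (a' == a)%:R) (fun b' => (b' == b)%:R)) u = u@_(a, b).
  rewrite -mpair_delta; apply: eq_bigr => -[a' b'] _; congr (_ * _).
  by rewrite /ftens -natrM mulnb -pair_eqE.
by rewrite -!E.
Qed.

Definition pr2 A B (t : HHsp k) : k :=
  mpair (ftens (fun b => qfact q b.2 * A b.1 b.2) (fun b => qfact q b.2 * B b.1 b.2)) t.

Lemma pr2_inj t t' : (forall A B, pr2 A B t = pr2 A B t') -> t = t'.
Proof.
move=> tt'; apply: ftens_inj => C D.
have := tt' (fun n m => C (n, m) / qfact q m) (fun n m => D (n, m) / qfact q m).
have E u : pr2 (fun n m => C (n, m) / qfact q m) (fun n m => D (n, m) / qfact q m) u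
           = mpair (ftens C D) u.
  apply: eq_bigr => -[[n m] [n' m']] _; congr (_ * _).
  by rewrite /ftens /= ![qfact _ _ * _]mulrC !divfK ?qfact_neq0.
by rewrite !E.
Qed.

(** The denominators of the q-binomial expansion cancel against the q-factorials of the two
    pairings, leaving the matrix product. *)
Lemma pr2_Delta A B v : pr2 A B (Delta q v) = pr (A ** B) v.
Proof.
rewrite /pr2 mpair_mext; apply: eq_bigr => -[n m] _; congr (_ * _).
rewrite mpair_DeltaB; congr (_ * _); apply: eq_bigr => i _.
by rewrite /ftens /=; field; rewrite !qfact_neq0.
Qed.

Lemma pr2_tmap A B phi t : linear phi ->
  pr2 A B (tmap phi phi t) = pr2 (dual phi A) (dual phi B) t.
Proof.
move=> phiL; rewrite /pr2 mpair_mext; apply: eq_bigr => -[[n m] [n' m']] _.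
by congr (_ * _); rewrite mpair_tens -!/(pr _ _) !prE.
Qed.

Lemma eps_pr v : eps v = pr (ione k) v.
Proof.
apply: eq_bigr => -[n [|m]] _; congr (_ * _); first by rewrite qfact0 mul1r.
by rewrite /epsB /= mulr0.
Qed.

(** The pairings separate vectors, so compatibility with coproduct and counit can be tested after
    transposition. *)
Lemma is_coalg_autP phi : linear phi -> bijective phi ->
  is_coalg_aut q phi <-> (forall A B, dual phi (A ** B) = dual phi A ** dual phi B) /\
                         dual phi (ione k) = ione k.
Proof.
move=> phiL phiB; split=> [[_ _ phiD phiE]|[phiM phi1]]; last first.
  split=> // v; last by rewrite !eps_pr pr_dual // phi1.
  apply: pr2_inj => A B.
  by rewrite pr2_Delta pr_dual // phiM (pr2_tmap _ _ _ phiL) pr2_Delta.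
split=> [A B|]; apply: inc_ext => n m; apply: (mulfI (qfact_neq0 m)).
  by rewrite -prE -[RHS]pr_mon -!pr2_Delta phiD pr2_tmap.
by rewrite -prE -[RHS]pr_mon -!eps_pr phiE.
Qed.

End Duality.

(** * Transposes of the generating automorphisms *)

Section Generators.
Set Implicit Arguments.
Unset Strict Implicit.
Variables (k : fieldType) (q : k).
Hypothesis hq : forall n : nat, (0 < n)%N -> q ^+ n != 1.
Let qf_neq0 := qfact_neq0 hq.
Local Notation dual := (transp q).
Local Notation pr := (pairing q).

Lemma lin_ext_linear (f : Bas -> Hsp k) : linear (lin_ext f).
Proof. exact: (mext_linear f). Qed.

Lemma lin_ext_mon (f : Bas -> Hsp k) n m : lin_ext f (mon k n m) = f (n, m).
Proof. by rewrite -[LHS]/(mext f _) mextU scale1r. Qed.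

Definition tau (a : (int -> k) * int) := phi_alpha a.1 \o theta k a.2.

Lemma tau_linear a : linear (tau a).
Proof. by apply: linear_comp_fun; apply: lin_ext_linear. Qed.

Lemma tau_mon a n m : tau a (mon k n m) = bprod a.1 (n + a.2) m *: mon k (n + a.2) m.
Proof. by rewrite /tau /= /theta lin_ext_mon /phi_alpha lin_ext_mon. Qed.

Lemma prZ A c v : pr A (c *: v) = c * pr A v. Proof. exact: mpairZ. Qed.

Lemma prD A u v : pr A (u + v) = pr A u + pr A v. Proof. exact: mpairD. Qed.

Lemma prB A u v : pr A (u - v) = pr A u - pr A v. Proof. exact: mpairB. Qed.

Lemma pr_sum A (I : Type) (r : seq I) (P : pred I) F :
  pr A (\sum_(i <- r | P i) F i) = \sum_(i <- r | P i) pr A (F i).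
Proof. exact: mpair_sum. Qed.

Lemma pr_monB A a b c n n' m :
  pr A (c *: (a *: mon k n m - b *: mon k n' m)) = c * (qfact q m * (a * A n m - b * A n' m)).
Proof.
have E x n1 : pr A (x *: mon k n1 m) = qfact q m * (x * A n1 m).
  by rewrite prZ pr_mon mulrCA.
rewrite prZ prB [in RHS]mulrBr; apply: (congr1 ( *%R c)).
exact: (f_equal2 (fun u v => u - v) (E a n) (E b n')).
Qed.

Lemma dual_tau a A : dual (tau a) A = itau a A.
Proof.
apply: inc_ext => n m; rewrite /transp tau_mon prZ pr_mon /itau.
by field; apply: qf_neq0.
Qed.

Lemma qfallM m i : (i <= m)%N -> qfall q m i * qfact q (m - i) = qfact q m.
Proof.
elim: i => [|i IH] lt_im; first by rewrite /qfall big_ord0 mul1r subn0.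
have eS : (m - i = (m - i.+1).+1)%N by lia.
by rewrite -IH 1?ltnW // /qfall big_ord_recr /= eS qfactS mulrA mulrAC.
Qed.

(** The q-binomials, written as quotients of q-factorials, telescope. *)
Lemma qbinom_itM m s i : (i * s <= m)%N ->
  qbinom_it q m s i = qfact q m / (qfact q (m - i * s) * qfact q s ^+ i).
Proof.
elim: i => [|i IH] le_m.
  by rewrite /qbinom_it big_ord0 subn0 mulr1 mulfV.
rewrite /qbinom_it big_ord_recr -/(qbinom_it q m s i) /= IH; last first.
  by apply: leq_trans le_m; rewrite leq_mul2r leqnSn orbT.
rewrite /qbinom -subnDA (addnC _ s) -mulSn exprS.
by field; rewrite !qf_neq0 expf_neq0.
Qed.

(** One formula covers [s = 1] and [s >= 2], its coefficients quotients of q-factorials; for [m < s]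
    the sum is empty. *)
Lemma phisBE t (beta : int -> k) n m : let s := t.+1 in
  phisB q s beta (n, m) = mon k n m + \sum_(i < m %/ s)
    (qfact q m / (qfact q (m - i.+1 * s) * qfact q s ^+ i.+1)) *:
    (bprod_s beta n s i.+1 *: mon k (n + (i.+1 * s)%N%:Z) (m - i.+1 * s)
     - (bprod_s beta n s i * beta (n + m%:Z - s%:Z)) *:
         mon k (n + (i.+1 * s)%N%:Z - s%:Z) (m - i.+1 * s)).
Proof.
rewrite /= /phisB /phi1B /=; move: (mon k) => e; case: eqP => [[->]|_].
  rewrite divn1; apply: (congr1 (fun u => e n m + u)).
  (* The sum over the remaining exponent l = m - (i + 1) is reversed to run over the drop in
     degree. *)
  rewrite [LHS](reindex_inj rev_ord_inj) /=; apply: eq_bigr => i _.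
  have lt_im : (i.+1 <= m)%N by case: i.
  rewrite (subKn lt_im).
  have bprodE l : bprod_s beta n 1 l = bprod beta n l.
    by apply: eq_bigr => j _; rewrite muln1.
  have qf1 : qfact q 1 = 1 by rewrite /qfact big_ord1 /qnum big_ord1 expr0.
  have -> : qfall q m i.+1 = qfact q m / qfact q (m - i.+1).
    by rewrite -(qfallM lt_im) mulfK.
  by rewrite muln1 subn1 /= !bprodE qf1 expr1n mulr1.
case: ltnP => [lt_mt|le_tm]; first by rewrite divn_small // big_ord0 addr0.
apply: (congr1 (fun u => e n m + u)); rewrite big_add1 /= big_mkord; apply: eq_bigr => i _.
rewrite qbinom_itM //; apply: leq_trans (leq_trunc_div m t.+1).
by rewrite leq_mul2r; case: i => i /= ->.
Qed.

(* [geom t b A] is [(ifac B t.+1)^-1 ** A] when [b] is the [t.+1]-st diagonal of [B]. *)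
Definition geom (t : nat) (b : int -> k) A : int -> nat -> k := fun n m =>
  \sum_(i < (m %/ t.+1).+1) bprod_s b n t.+1 i * A (n + (i * t.+1)%N%:Z) (m - i * t.+1)%N.

(** With D the diagonal in degree [t.+1], [geom] is the sum of all D^i A, and multiplying it by D
    drops the first term. *)
Lemma ifac_geom t (B : int -> nat -> k) A :
  ifac B t.+1 ** geom t (B^~ t.+1) A = A.
Proof.
apply: inc_ext => n m; rewrite ifac_imul {1}/geom big_ord_recl {1}/bprod_s big_ord0.
rewrite mul1r addr0 subn0 -addrA -[RHS]addr0; congr (_ + _).
case: ltnP => [lt_tm|le_mt]; last by rewrite divn_small // big_ord0 subr0.
rewrite /geom mulr_sumr.
have -> : (m %/ t.+1 = ((m - t.+1) %/ t.+1).+1)%N.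
  by rewrite -{1}(subnK lt_tm) divnDr // divnn addn1.
rewrite -sumrB big1 // => i _; apply/eqP; rewrite subr_eq0; apply/eqP.
rewrite /bprod_s big_ord_recl /= addr0 -mulrA /bump /= add1n.
rewrite -subnDA -mulSn; congr (_ * (_ * A _ _)).
  by apply: eq_bigr => j _; rewrite add1n mulSn PoszD addrA.
by rewrite mulSn PoszD addrA.
Qed.

(** In each bracket of phi^(s) the first term comes from the geometric series, the second from the
    preceding term of the series times D on the right. Dividing beta by (s)!_q absorbs the powers of
    (s)!_q. *)
Lemma dual_phisB t (beta : int -> k) A (B : int -> nat -> k) :
    (forall n, B n t.+1 = beta n / qfact q t.+1) ->
  dual (lin_ext (phisB q t.+1 beta)) A = geom t (B^~ t.+1) A ** ifac B t.+1.
Proof.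
move=> Bt; apply: inc_ext => n m; rewrite imul_ifac /transp lin_ext_mon phisBE.
have Bprod n' i : bprod_s (B^~ t.+1) n' t.+1 i
                  = bprod_s beta n' t.+1 i / qfact q t.+1 ^+ i.
  rewrite /bprod_s (eq_bigr _ (fun j _ => Bt _)) big_split /=; congr (_ * _).
  by rewrite prodr_const card_ord exprVn.
rewrite prD pr_sum pr_mon mulrDl mulr_suml.
rewrite [_ * A n m]mulrC mulfK // /geom big_ord_recl [bprod_s _ _ _ 0]big_ord0.
rewrite mul1r addr0 subn0 -[RHS]addrA; congr (_ + _).
rewrite (_ : (if _ then _ else _) = \sum_(i < m %/ t.+1)
  bprod_s (B^~ t.+1) n t.+1 i * A (n + (i * t.+1)%N%:Z) (m - i.+1 * t.+1)%N *
  B (n + (m - t.+1)%N%:Z) t.+1); last first.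
  case: ltnP => [lt_tm|le_mt]; last by rewrite divn_small // big_ord0.
  have -> : (m %/ t.+1 = ((m - t.+1) %/ t.+1).+1)%N.
    by rewrite -{1}(subnK lt_tm) divnDr // divnn addn1.
  rewrite mulr_suml; apply: eq_bigr => i _.
  by rewrite -subnDA -mulSn.
rewrite -sumrB; apply: eq_bigr => i _.
have le_im : (i.+1 * t.+1 <= m)%N.
  apply: leq_trans (leq_trunc_div m t.+1).
  by rewrite leq_mul2r; case: i => i /= ->.
have le_tm : (t.+1 <= m)%N by apply: leq_trans le_im; rewrite leq_pmull.
rewrite pr_monB !Bprod Bt.
have -> : n + (m - t.+1)%N%:Z = n + m%:Z - t.+1%:Z by rewrite -subzn // addrA.
have -> : n + (i.+1 * t.+1)%N%:Z - t.+1%:Z = n + (i * t.+1)%N%:Z.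
  by rewrite mulSn PoszD addrA addrAC addrK.
rewrite /bump /= exprS; field.
by rewrite !qf_neq0 expf_neq0.
Qed.

Definition Gcoef (g : Ginf k) : int -> nat -> k := fun n m => g m.-1 n / qfact q m.

Lemma Phi_linear g : linear (Phi q g).
Proof. exact: lin_ext_linear. Qed.

Lemma dual_Phi g A : wprod (Gcoef g) ** dual (Phi q g) A = A ** wprod (Gcoef g).
Proof.
(* [X t] is [A] after the transposes of phi^(1), ..., phi^(t) in this order, each conjugating by its
   factor 1 - D_s. *)
pose X := fix X t := if t is t'.+1 then dual (lin_ext (phisB q t'.+1 (g t'))) (X t') else A.
rewrite -(wprod_intertwine (X := X) (A := A)) //=; last first.
  move=> t; have Bg n : Gcoef g n t.+1 = g t n / qfact q t.+1 by [].
  by rewrite (dual_phisB _ Bg) imulA ifac_geom.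
(* On x^n y^m the map [Phi q g] uses only the first [m] factors, which is how [ilim] reads degree
   [m]. *)
congr (_ ** _); apply: inc_ext => n m.
rewrite /transp /Phi lin_ext_mon /ilim /=.
(* Factors cross the pairing one at a time, outermost first. *)
suff E j t v : pr (X j) (foldr (fun s acc => lin_ext (phisB q s (g s.-1)) \o acc) id
    (iota j.+1 t) v) = pr (X (j + t)%N) v.
  by rewrite -[A]/(X 0%N) E add0n pr_mon mulrC mulKf.
elim: t j => [|t IH] j; first by rewrite addn0.
by rewrite addnS -addSn -(IH j.+1); apply: (pr_dual hq _ _ (@lin_ext_linear _)).
Qed.

End Generators.

(** * Groups of conjugations and rescalings *)

Section Groups.
Set Implicit Arguments.
Unset Strict Implicit.
Variables (k : fieldType) (q : k).
Hypothesis hq : forall n : nat, (0 < n)%N -> q ^+ n != 1.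
Let qf_neq0 := qfact_neq0 hq.
Local Notation dual := (transp q).
Local Notation pr := (pairing q).
Local Notation W g := (wprod (Gcoef q g)).

Lemma Phi_mon0 (g : Ginf k) n : Phi q g (mon k n 0) = mon k n 0.
Proof. by rewrite /Phi lin_ext_mon. Qed.

Lemma Phi_mon1 (g : Ginf k) n :
  Phi q g (mon k n 1) = mon k n 1 + g 0%N n *: (mon k (n + 1) 0 - mon k n 0).
Proof.
rewrite /Phi lin_ext_mon /= lin_ext_mon /phisB /= /phi1B /= big_ord1 /=.
rewrite /qfall big_ord1 subn0 /qnum big_ord1 expr0 scale1r /bprod big_ord1 big_ord0.
by rewrite !addr0 !addrK mul1r scalerBr.
Qed.

Lemma imul_cancel (A B C : int -> nat -> k) : unitri A -> A ** B = A ** C -> B = C.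
Proof.
by case/iinvP=> V [_ _ VA] BC; rewrite -[B]imul1 -VA -imulA BC imulA VA imul1.
Qed.

Lemma is_coalg_aut_comp (phi psi : Hsp k -> Hsp k) :
  is_coalg_aut q phi -> is_coalg_aut q psi -> is_coalg_aut q (phi \o psi).
Proof.
move=> Hphi Hpsi; have [phiL phiB _ _] := Hphi; have [psiL psiB _ _] := Hpsi.
have [phiM phi1] := (is_coalg_autP hq phiL phiB).1 Hphi.
have [psiM psi1] := (is_coalg_autP hq psiL psiB).1 Hpsi.
have comp := dual_comp hq psi _ phiL.
apply/(is_coalg_autP hq); [exact: linear_comp_fun | exact: bij_comp |].
by split=> [A B|]; rewrite !comp ?phi1 // phiM psiM.
Qed.

(** For unitriangular [w], the transpose of [phi] is A |-> w^-1 A w, stated without the inverse. *)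
Definition conj_by (w : int -> nat -> k) (phi : Hsp k -> Hsp k) :=
  linear phi /\ forall A, w ** dual phi A = A ** w.

Definition scal_by (a : (int -> k) * int) (phi : Hsp k -> Hsp k) :=
  linear phi /\ forall A, dual phi A = itau a A.

(** Transposition and A |-> w^-1 A w both reverse order, so the matrices multiply in the order of
    composition. *)
Lemma conj_by_comp u v phi psi :
  conj_by u phi -> conj_by v psi -> conj_by (u ** v) (phi \o psi).
Proof.
move=> [phiL phiE] [psiL psiE]; split=> [|A]; first exact: linear_comp_fun.
by rewrite (dual_comp hq _ _ phiL) -imulA psiE imulA phiE imulA.
Qed.

Lemma conj_by_id : conj_by (ione k) id.
Proof. by split=> // A; rewrite (dual_id hq) imul1 imulr1. Qed.

Lemma conj_by_eq w phi psi : unitri w -> conj_by w phi -> conj_by w psi -> phi = psi.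
Proof.
move=> w1 [phiL phiE] [psiL psiE]; apply: (dual_inj hq) => // A.
by apply: (imul_cancel w1); apply: etrans (phiE A) (esym (psiE A)).
Qed.

(** The quotient u v^-1 is central, so it commutes with the diagonal idempotents and is diagonal;
    being unitriangular, it is 1. *)
Lemma conj_by_uniq u v phi :
  unitri u -> unitri v -> conj_by u phi -> conj_by v phi -> u = v.
Proof.
move=> u1 v1 [_ uE] [_ vE]; have [V [V1 vV Vv]] := iinvP v1.
pose Z := u ** V.
have ZA A : Z ** A = A ** Z.
  have Vd : V ** A = dual phi A ** V.
    by rewrite -[LHS]imulr1 -vV imulA -(imulA V A) -vE imulA Vv imul1.
  by rewrite /Z -imulA Vd imulA uE imulA.
suff Z1 : Z = ione k by rewrite -[LHS]imulr1 -Vv imulA -/Z Z1 imul1.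
apply: inc_ext => n [|m]; first by rewrite /Z (unitri_mul u1 V1).
pose E (n' : int) (m' : nat) : k := ((n' == n) && (m' == 0%N))%:R.
have := congr1 (fun A => A n m.+1) (ZA E).
rewrite /imul [RHS]big_ord_recl [in RHS]big1 => [|i _]; last by rewrite /E andbF mul0r.
rewrite [LHS]big1 => [|i _]; first by rewrite /E !eqxx mul1r !addr0 subn0 => <-.
rewrite /E (_ : _ && _ = false) ?mulr0 //; case: i => i /= lt_i; lia.
Qed.

Lemma conj_by_aut w phi : unitri w -> bijective phi -> conj_by w phi -> is_coalg_aut q phi.
Proof.
move=> w1 phiB [phiL phiE]; apply/(is_coalg_autP hq) => //.
split=> [A B|]; apply: (imul_cancel w1); last by rewrite phiE imul1 imulr1.
by rewrite phiE imulA phiE -imulA -phiE imulA.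
Qed.

Lemma scal_by_aut a phi : bijective phi -> scal_by a phi -> is_coalg_aut q phi.
Proof.
move=> phiB [phiL phiE]; apply/(is_coalg_autP hq) => //.
by split=> [A B|]; rewrite !phiE ?itau_mul // itau_one.
Qed.

Lemma scal_by_eq a phi psi : scal_by a phi -> scal_by a psi -> phi = psi.
Proof.
move=> [phiL phiE] [psiL psiE]; apply: (dual_inj hq) => // A.
by apply: etrans (phiE A) (esym (psiE A)).
Qed.

(** Applying [itau a] to an equation of conjugation by [w'] gives one of conjugation by
    [itau a w']. *)
Lemma conj_scal a w w' phi phi' ta : unitri w -> itau a w' = w ->
  conj_by w phi -> conj_by w' phi' -> scal_by a ta -> phi' \o ta = ta \o phi.
Proof.
move=> w1 ww [phiL phiE] [phi'L phi'E] [taL taE].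
apply: (dual_inj hq); [exact: linear_comp_fun | exact: linear_comp_fun | move=> A].
rewrite (dual_comp hq _ _ taL) (dual_comp hq _ _ phi'L); apply: (imul_cancel w1).
by rewrite phiE !taE -ww -!itau_mul phi'E.
Qed.

Lemma bprodM (al be : int -> k) n m :
  bprod (fun i => al i * be i) n m = bprod al n m * bprod be n m.
Proof. by rewrite /bprod big_split. Qed.

Lemma bprodV (al : int -> k) n m : bprod (fun i => (al i)^-1) n m = (bprod al n m)^-1.
Proof. by rewrite /bprod prodfV. Qed.

Lemma bprod1 n m : bprod (fun _ => 1 : k) n m = 1.
Proof. by rewrite /bprod big1. Qed.

Lemma bprod_neq0 (al : int -> k) n m : unit_seq al -> bprod al n m != 0.
Proof. by move=> al0; rewrite /bprod; apply/prodf_neq0 => i _; apply: al0. Qed.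

Lemma bprod_shift (al : int -> k) r n m : bprod (fun i => al (i + r)) n m = bprod al (n + r) m.
Proof. by apply: eq_bigr => i _; rewrite addrAC. Qed.

(** Carrying the rescaling [b.1] across the translation by [a.2] shifts its argument: this is the
    twist in [sd_mul]. *)
Lemma scal_by_comp a b ta tb :
  scal_by a ta -> scal_by b tb -> scal_by (sd_mul a b) (ta \o tb).
Proof.
move=> [taL taE] [tbL tbE]; split=> [|A]; first exact: linear_comp_fun.
rewrite (dual_comp hq _ _ taL) tbE taE; apply: inc_ext => n m.
rewrite /itau /sd_mul /= bprodM (bprod_shift b.1 (- a.2)).
have -> : n + (a.2 + b.2) = n + b.2 + a.2 by ring.
by rewrite addrK mulrCA mulrA.
Qed.

Lemma scal_by_id : scal_by (fun _ => 1, 0) id.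
Proof.
split=> // A; rewrite (dual_id hq); apply: inc_ext => n m.
by rewrite /itau bprod1 mul1r addr0.
Qed.

Definition sd_inv (a : (int -> k) * int) : (int -> k) * int :=
  (fun n => (a.1 (n + a.2))^-1, - a.2).

Lemma sd_mulV a : unit_seq a.1 -> sd_mul a (sd_inv a) = (fun _ => 1, 0).
Proof.
move=> a0; rewrite /sd_mul /= subrr; congr (_, _).
by apply: functional_extensionality => n; rewrite subrK mulfV.
Qed.

Lemma sd_mulVl a : unit_seq a.1 -> sd_mul (sd_inv a) a = (fun _ => 1, 0).
Proof.
move=> a0; rewrite /sd_mul /= addNr; congr (_, _).
by apply: functional_extensionality => n; rewrite opprK mulVf.
Qed.

(** The q-factorials are invertible, so [Gcoef] realises any diagonals of positive degree. *)
Lemma W_surj A : unitri A -> exists g : Ginf k, W g = A.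
Proof.
case/wprod_surj=> B <-; exists (fun i n => B n i.+1 * qfact q i.+1).
by apply: eq_wprod => n m; rewrite /Gcoef mulfK.
Qed.

Lemma W_inj (g h : Ginf k) : W g = W h -> g = h.
Proof.
move/wprod_inj=> gh; do 2![apply: functional_extensionality => ?].
by have := gh _ _; rewrite /Gcoef /= => /(_ _ _)/divIf; apply.
Qed.

Lemma Phi_conj (g : Ginf k) : conj_by (W g) (Phi q g).
Proof. by split; [apply: Phi_linear | apply: dual_Phi]. Qed.

Lemma unitri_W (g : Ginf k) : unitri (W g).
Proof. exact: unitri_wprod. Qed.

Lemma conj_by_Phi (g : Ginf k) w phi : W g = w -> conj_by w phi -> Phi q g = phi.
Proof.
move=> <- phiE; exact: conj_by_eq (unitri_W g) (Phi_conj g) phiE.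
Qed.

(** The inverse of [W g] is unitriangular, hence of the form [W g']. *)
Lemma Phi_inv (g : Ginf k) : exists g' : Ginf k,
  [/\ W g ** W g' = ione k, Phi q g \o Phi q g' = id & Phi q g' \o Phi q g = id].
Proof.
have [V [V1 WV VW]] := iinvP (unitri_W g); have [g' Wg'] := W_surj V1.
have ione1 : unitri (ione k) by [].
exists g'; split; first by rewrite Wg'.
  apply: (conj_by_eq ione1 _ conj_by_id).
  by rewrite -WV -Wg'; apply: conj_by_comp; apply: Phi_conj.
apply: (conj_by_eq ione1 _ conj_by_id).
by rewrite -VW -Wg'; apply: conj_by_comp; apply: Phi_conj.
Qed.

Lemma Phi_inj (g h : Ginf k) : Phi q g = Phi q h -> g = h.
Proof.
move=> gh; apply/W_inj/(conj_by_uniq (unitri_W g) (unitri_W h) (Phi_conj g)).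
by rewrite gh; apply: Phi_conj.
Qed.

Lemma Phi_bij (g : Ginf k) : bijective (Phi q g).
Proof.
have [g' [_ gg' g'g]] := Phi_inv g.
by exists (Phi q g') => v; [apply: (congr1 (@^~ v) g'g) | apply: (congr1 (@^~ v) gg')].
Qed.

Lemma Phi_aut (g : Ginf k) : is_coalg_aut q (Phi q g).
Proof. exact: conj_by_aut (unitri_W g) (Phi_bij g) (Phi_conj g). Qed.

Lemma tau_scal a : scal_by a (tau a).
Proof. by split; [apply: tau_linear | apply: dual_tau]. Qed.

Lemma tau_comp (a b : (int -> k) * int) : tau (sd_mul a b) = tau a \o tau b.
Proof. exact: scal_by_eq (tau_scal _) (scal_by_comp (tau_scal a) (tau_scal b)). Qed.

Lemma tau_id : tau (fun _ => 1 : k, 0) = id.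
Proof. exact: scal_by_eq (tau_scal _) scal_by_id. Qed.

Lemma tauK a : unit_seq a.1 -> tau a \o tau (sd_inv a) = id.
Proof. by move=> a0; rewrite -tau_comp sd_mulV // tau_id. Qed.

Lemma tauVK a : unit_seq a.1 -> tau (sd_inv a) \o tau a = id.
Proof. by move=> a0; rewrite -tau_comp sd_mulVl // tau_id. Qed.

Lemma tau_aut a : unit_seq a.1 -> is_coalg_aut q (tau a).
Proof.
move=> a0; apply: scal_by_aut (tau_scal a); exists (tau (sd_inv a)) => v.
  exact: (congr1 (@^~ v) (tauVK a0)).
exact: (congr1 (@^~ v) (tauK a0)).
Qed.

(** The inverses in [act] cancel the weights of [itau] and its shift undoes the translation, so
    [itau a] carries [W (act a g)] to [W g]. *)
Lemma Phi_act (a : (int -> k) * int) (g : Ginf k) : unit_seq a.1 ->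
  Phi q (act a g) \o tau a = tau a \o Phi q g.
Proof.
move=> a0; apply: (conj_scal (unitri_W g) _ (Phi_conj g) (Phi_conj _) (tau_scal a)).
rewrite itau_wprod; apply: eq_wprod => n m; rewrite /itau /Gcoef /act /=.
rewrite -[\prod_(j < _) _]/(bprod (fun i => (a.1 i)^-1) _ _) bprodV addrK.
by rewrite !mulrA mulfV ?mul1r // bprod_neq0.
Qed.

Lemma act1 (g : Ginf k) : act ((fun _ => 1 : k), 0) g = g.
Proof.
do 2![apply: functional_extensionality => ?].
by rewrite /act /= subr0 big1 ?mul1r // => i _; rewrite invr1.
Qed.

Lemma actM (a b : (int -> k) * int) (g : Ginf k) : act (sd_mul a b) g = act a (act b g).
Proof.
apply: functional_extensionality => i; apply: functional_extensionality => n.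
rewrite /act /= mulrA -big_split /= opprD addrA; congr (_ * _).
by apply: eq_bigr => j _; rewrite invfM addrAC.
Qed.

Lemma act_bij (a : (int -> k) * int) : unit_seq a.1 -> bijective (act a).
Proof.
move=> a0; exists (act (sd_inv a)) => g; rewrite -actM.
  by rewrite sd_mulVl // act1.
by rewrite sd_mulV // act1.
Qed.

End Groups.

(** * Classification of coalgebra automorphisms *)

Section Classification.
Set Implicit Arguments.
Unset Strict Implicit.
Variables (k : fieldType) (q : k).
Hypothesis hq : forall n : nat, (0 < n)%N -> q ^+ n != 1.
Let qf_neq0 := qfact_neq0 hq.
Local Notation dual := (transp q).
Local Notation pr := (pairing q).
Local Notation W g := (wprod (Gcoef q g)).
Implicit Type phi : Hsp k -> Hsp k.

(** The matrix unit at position [(c, c + j)]. *)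
Definition munit (c : int) (j : nat) : int -> nat -> k :=
  fun n m => ((n == c) && (m == j))%:R.

Definition multiplicative phi := forall A B, dual phi (A ** B) = dual phi A ** dual phi B.

Lemma mcoeff_mon c j n m : (mon k n m)@_(c, j) = munit c j n m.
Proof. by rewrite mcoeffU -pair_eqE. Qed.

Lemma mon_neq0 n m : mon k n m != 0.
Proof. by rewrite monalgU_eq0 oner_eq0. Qed.

Lemma mon_inj n m n' m' : mon k n m = mon k n' m' -> n = n' /\ m = m'.
Proof.
move/(congr1 (mcoeff (n, m))); rewrite !mcoeff_mon /munit !eqxx /=.
by case: andP => [[/eqP-> /eqP->]|_ /eqP]; rewrite ?oner_eq0.
Qed.

Lemma mcoeff_dual phi c j n m :
  (phi (mon k n m))@_(c, j) = qfact q m / qfact q j * dual phi (munit c j) n m.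
Proof.
have E v : pr (munit c j) v = qfact q j * v@_(c, j).
  rewrite -mpair_delta mulrC /pairing /mpair mulr_suml; apply: eq_bigr => -[c' j'] _.
  rewrite /munit /= -mulrA; congr (_ * _).
  rewrite -pair_eqE /=; case: andP => [[_ /eqP->]|_].
    by rewrite mulr1 mul1r.
  by rewrite mulr0 mul0r.
by rewrite /transp E; field; rewrite !qf_neq0.
Qed.

Lemma munit_mul c i d j : munit c i ** munit d j =
  if d == c + i%:Z then munit c (i + j)%N else fun _ _ => 0.
Proof.
apply: inc_ext => n m.
have -> : (if d == c + i%:Z then munit c (i + j)%N else fun _ _ => 0) n m
        = ((d == c + i%:Z) && (n == c) && (m == i + j)%N)%:R.
  by case: ifP.
case: (ltnP m i) => [lt_mi|le_im].
  rewrite [RHS](_ : _ = 0); last by rewrite (_ : m == _ = false) ?andbF //; lia.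
  rewrite /imul big1 // => l _; rewrite /munit (_ : (l : nat) == i = false) ?andbF ?mul0r //.
  by case: l => l /=; lia.
rewrite /imul (bigD1 (Ordinal (le_im : (i < m.+1)%N))) //= big1 ?addr0; last first.
  move=> l neq_l; rewrite /munit (_ : (l : nat) == i = false) ?andbF ?mul0r //.
  by apply: contraNF neq_l => /eqP eq_l; apply/eqP/val_inj.
rewrite /munit eqxx andbT -natrM mulnb; congr (nat_of_bool _)%:R.
case: (n =P c) => [->|_]; rewrite ?andbF ?andbT //= eq_sym; congr (_ && _).
by lia.
Qed.

Lemma munit_imul c A n m : (munit c 0 ** A) n m = (n == c)%:R * A n m.
Proof.
rewrite /imul big_ord_recl big1 => [|i _]; last by rewrite /munit andbF mul0r.
by rewrite /munit eqxx andbT !addr0 subn0.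
Qed.

Lemma imul_munit c A n m : (A ** munit c 0) n m = A n m * (n + m%:Z == c)%:R.
Proof.
rewrite /imul big_ord_recr big1 /= => [|i _].
  by rewrite add0r subnn /munit eqxx andbT.
by rewrite /munit (_ : (m - i == 0)%N = false) ?andbF ?mulr0 //; case: i => i /=; lia.
Qed.

Lemma dual0 phi : dual phi (fun _ _ => 0) = fun _ _ => 0.
Proof.
apply: inc_ext => n m; rewrite /transp /pairing /mpair big1 ?mul0r // => b _.
by rewrite !mulr0.
Qed.

(* A coalgebra map sends the group-like [x^n] to a character of the incidence algebra, and
   nilpotents such as [munit c i], [i > 0], vanish under characters. *)
Lemma dual_munit_x phi c i n : multiplicative phi -> (0 < i)%N ->
  dual phi (munit c i) n 0 = 0.
Proof.
move=> phiM i_gt0; have := phiM (munit c i) (munit c i).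
rewrite munit_mul (_ : c == _ = false); last by lia.
rewrite dual0 => /(congr1 (fun A => A n 0%N)); rewrite /imul big_ord1 addr0.
by move/esym/eqP; rewrite mulf_eq0 orbb => /eqP.
Qed.

(** A character takes the orthogonal idempotents [munit d 0] to orthogonal idempotents of the field,
    so at most one value is nonzero, and that one is 1. *)
Lemma grouplike_image phi n : multiplicative phi -> phi (mon k n 0) != 0 ->
  exists c, phi (mon k n 0) = mon k c 0.
Proof.
move=> phiM phi0.
have [[c j] supp_c] : exists b, b \in msupp (phi (mon k n 0)).
  apply/fset0Pn; apply: contraNneq phi0 => s0; apply/eqP/malgP => b.
  by rewrite mcoeff0 mcoeff_outdom // s0 inE.
have coef d i : (phi (mon k n 0))@_(d, i.+1) = 0.
  by rewrite mcoeff_dual dual_munit_x ?mulr0.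
have coef0 d : (phi (mon k n 0))@_(d, 0%N) = dual phi (munit d 0) n 0.
  by rewrite mcoeff_dual qfact0 divr1 mul1r.
have dualM d d' : dual phi (munit d 0) n 0 * dual phi (munit d' 0) n 0
                = (d' == d)%:R * dual phi (munit d 0) n 0.
  have := congr1 (fun A => A n 0%N) (phiM (munit d 0) (munit d' 0)).
  rewrite [in RHS]/imul big_ord1 addr0 => <-; rewrite munit_mul addr0.
  by case: eqP => _; rewrite ?dual0 ?mul0r ?mul1r.
move: supp_c; rewrite -mcoeff_neq0; case: j => [|j]; last by rewrite coef eqxx.
rewrite coef0 => s_neq0.
exists c; apply/malgP => -[d [|i]]; rewrite mcoeff_mon /munit /= ?andbF ?coef //.
rewrite coef0 andbT; apply: (mulfI s_neq0); rewrite dualM eq_sym mulrC.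
by case: eqP => [->|]; rewrite ?mulr0.
Qed.

Lemma coalg_multiplicative phi : is_coalg_aut q phi -> multiplicative phi.
Proof. by move=> H; have [phiL phiB _ _] := H; case/(is_coalg_autP hq phiL phiB): H. Qed.

Lemma linear_eq0 phi v : linear phi -> injective phi -> (phi v == 0) = (v == 0).
Proof.
move=> phiL phiI; have phi0 : phi 0 = 0.
  by rewrite -{1}(scale0r (0 : Hsp k)) (linearZ_fun _ _ phiL) scale0r.
by rewrite -{1}phi0 (inj_eq phiI).
Qed.

Lemma dual_munit_mon phi n c d : phi (mon k n 0) = mon k c 0 ->
  dual phi (munit d 0) n 0 = (c == d)%:R.
Proof.
move=> phin; have := mcoeff_dual phi d 0 n 0.
by rewrite phin mcoeff_mon /munit eqxx andbT qfact0 divr1 mul1r => ->.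
Qed.

(* [phi (x^n y)] has a nonzero component of degree 1, as otherwise the inverse of [phi], which
   preserves group-likes, would make [x^n y] a combination of group-likes; skew-primitivity
   then places this component at [x^c y], between [x^c] and [x^(c+1)]. *)
Lemma grouplike_next phi n c d : is_coalg_aut q phi ->
  phi (mon k n 0) = mon k c 0 -> phi (mon k (n + 1) 0) = mon k d 0 -> d = c + 1.
Proof.
move=> H phin phin1; have phiM := coalg_multiplicative H.
have [phiL [psi psiK phiK] _ _] := H.
have psiL : linear psi by move=> a u v; apply: (can_inj psiK); rewrite phiK phiL !phiK.
have psiM : multiplicative psi.
  have pp A : dual psi (dual phi A) = A.
    rewrite -(dual_comp hq _ _ phiL) -[RHS](dual_id hq); congr (dual _ _).
    exact: functional_extensionality.
  have pp' A : dual phi (dual psi A) = A.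
    rewrite -(dual_comp hq _ _ psiL) -[RHS](dual_id hq); congr (dual _ _).
    exact: functional_extensionality.
  by move=> A B; rewrite -{1}(pp' A) -{1}(pp' B) -phiM pp.
have split2 A B : dual phi (A ** B) n 1%N =
    dual phi A n 0%N * dual phi B n 1%N + dual phi A n 1%N * dual phi B (n + 1) 0%N.
  by rewrite phiM /imul big_ord_recl big_ord1 /= addr0.
(* A matrix unit of degree at least 2 is a product of two of positive degree, which vanish under the
   characters at both ends. *)
have coef2 e j : (phi (mon k n 1))@_(e, j.+2) = 0.
  rewrite mcoeff_dual (_ : munit e j.+2 = munit e 1 ** munit (e + 1) j.+1).
    by rewrite split2 !dual_munit_x // mul0r mulr0 addr0 mulr0.
  by rewrite munit_mul eqxx.
have [e Ce] : exists e, dual phi (munit e 1) n 1 != 0.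
  have [/hasP[[e j] /= supp_e /eqP Ej]|/hasPn no1] :=
      boolP (has (fun b => b.2 == 1%N) (msupp (phi (mon k n 1)))).
    exists e; move: supp_e; rewrite Ej -mcoeff_neq0 mcoeff_dual.
    by apply: contraNneq => ->; rewrite mulr0.
  suff /eqP : pr (munit n 1) (psi (phi (mon k n 1))) = 0.
    by rewrite psiK pr_mon /munit !eqxx mulr1 (negbTE (qf_neq0 1)).
  rewrite (pr_dual hq _ _ psiL) /pairing /mpair big_seq big1 // => -[e [|[|j]]] /= supp_e.
  - by rewrite dual_munit_x // !mulr0.
  - by have := no1 _ supp_e.
  - by rewrite coef2 mul0r.
(* Multiplying [munit e 1] by its left idempotent identifies [c]; below, the right idempotent
   identifies [d]. *)
have ce : c = e.
  have E1 : munit e 1 = munit e 0 ** munit e 1 by rewrite munit_mul addr0 eqxx.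
  move: Ce; rewrite E1 split2 (@dual_munit_x phi e 1) // mulr0 addr0.
  by rewrite (dual_munit_mon _ phin); case: (c =P e) => // _; rewrite mul0r eqxx.
have E1 : munit e 1 = munit e 1 ** munit (e + 1) 0 by rewrite munit_mul eqxx.
move: Ce; rewrite E1 split2 (@dual_munit_x phi e 1) // mul0r add0r.
by rewrite (dual_munit_mon _ phin1) -ce; case: (d =P c + 1) => // _; rewrite mulr0 eqxx.
Qed.

(** By [grouplike_next] the permutation of group-likes commutes with the successor, so the image of
    1 determines it, by induction upwards and downwards. *)
Lemma grouplike_shift phi : is_coalg_aut q phi ->
  exists r, forall n, phi (mon k n 0) = mon k (n + r) 0.
Proof.
move=> H; have phiM := coalg_multiplicative H; have [phiL phiB _ _] := H.
have ex n : exists c, phi (mon k n 0) = mon k c 0.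
  apply: grouplike_image => //.
  by rewrite (linear_eq0 _ phiL (bij_inj phiB)) mon_neq0.
have [r phi0] := ex 0; exists r.
have up (m : nat) : phi (mon k m%:Z 0) = mon k (m%:Z + r) 0.
  elim: m => [|m IH]; first by rewrite phi0 add0r.
  have [d phid] := ex m.+1%:Z.
  have eS : m.+1%:Z = m%:Z + 1 by lia.
  rewrite eS in phid; rewrite eS phid (grouplike_next H IH phid); congr (mon k _ _).
  by ring.
have down (m : nat) : phi (mon k (- m%:Z) 0) = mon k (- m%:Z + r) 0.
  elim: m => [|m IH]; first by rewrite oppr0 phi0 add0r.
  have [c phic] := ex (- m.+1%:Z).
  have eS : - m%:Z = - m.+1%:Z + 1 by lia.
  rewrite eS in IH; have := grouplike_next H phic IH => e; rewrite phic.
  by congr (mon k _ _); lia.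
by case=> m; [apply: up | rewrite NegzE; apply: down].
Qed.

(** Fixing the idempotents preserves each one-dimensional corner E_c A E_(c+j), so every matrix unit
    is scaled. By multiplicativity the scalars are products of those in degree 1, nonzero by
    injectivity. *)
Lemma diagonal_aut phi : is_coalg_aut q phi ->
  (forall c, dual phi (munit c 0) = munit c 0) ->
  exists2 alpha, unit_seq alpha & phi = tau (alpha, 0).
Proof.
move=> H phiE; have phiM := coalg_multiplicative H; have [phiL phiB _ _] := H.
have offdiag c j n m : (n == c) && (m == j) = false -> dual phi (munit c j) n m = 0.
  move=> neq; have -> : munit c j = munit c 0 ** munit c j ** munit (c + j%:Z) 0.
    by rewrite munit_mul addr0 eqxx munit_mul eqxx addn0.
  rewrite !phiM !phiE imul_munit munit_imul; move: neq; case: eqP => [->|_] /=.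
    rewrite (inj_eq (addrI c)) eqz_nat => ->; exact: mulr0.
  by rewrite !mul0r.
pose gam n m := dual phi (munit n m) n m.
have phi_gam n m : phi (mon k n m) = gam n m *: mon k n m.
  apply/malgP => -[c j]; rewrite mcoeffZ mcoeff_mon mcoeff_dual /munit.
  case: (boolP ((n == c) && (m == j))) => [/andP[/eqP<- /eqP<-]|/negbTE neq].
    by rewrite mulfV // mul1r mulr1.
  by rewrite offdiag // !mulr0.
have gam0 n : gam n 0%N = 1 by rewrite /gam phiE /munit !eqxx.
have gamS n m : gam n m.+1 = gam n m * gam (n + m%:Z) 1%N.
  rewrite /gam; have -> : munit n m.+1 = munit n m ** munit (n + m%:Z) 1.
    by rewrite munit_mul eqxx addn1.
  rewrite phiM {1}/imul 2!big_ord_recr big1 /= => [|i _].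
    rewrite add0r subSnn [X in _ + X](_ : _ = 0) ?addr0 //.
    by rewrite offdiag ?mul0r // eqxx /= gtn_eqF.
  by rewrite offdiag ?mul0r // eqxx /= ltn_eqF.
exists (fun n => gam n 1%N) => [n|].
  have := linear_eq0 (mon k n 1) phiL (bij_inj phiB).
  rewrite phi_gam (negbTE (mon_neq0 _ _)) => /negbT.
  by apply: contraNneq => ->; rewrite scale0r.
apply: linear_malg_ext => //; first exact: tau_linear.
move=> [n m]; rewrite -[<< _ >>]/(mon k n m) phi_gam tau_mon addr0; congr (_ *: _).
elim: m => [|m IH]; first by rewrite gam0 /bprod big_ord0.
by rewrite gamS IH /bprod big_ord_recr.
Qed.

Lemma unipotent_diagonal phi : is_coalg_aut q phi ->
  (forall n, phi (mon k n 0) = mon k n 0) ->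
  exists g alpha, unit_seq alpha /\ phi = tau (alpha, 0) \o Phi q g.
Proof.
move=> H phi_x; have phiM := coalg_multiplicative H; have [phiL phiB _ _] := H.
(* Conjugating by [u] turns the idempotents [dual phi (munit c 0)] into [munit c 0]. *)
pose u n m := dual phi (munit n 0) n m.
have u1 : unitri u by move=> n; rewrite /u (dual_munit_mon _ (phi_x n)) eqxx.
(* Row [n] of [u] is row [n] of F_n, so this is the orthogonality of the F_n. *)
have uF c : u ** dual phi (munit c 0) = munit c 0 ** u.
  apply: inc_ext => n m; rewrite munit_imul.
  transitivity ((dual phi (munit n 0) ** dual phi (munit c 0)) n m) => //.
  rewrite -phiM munit_mul addr0 eq_sym.
  by case: eqP => _; rewrite ?dual0 ?mul0r ?mul1r.
(* With u = W g, composing with the inverse of [Phi q g] undoes the conjugation and fixes every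
   idempotent. *)
have [g Wg] := W_surj hq u1; have [g' [WW gg' g'g]] := Phi_inv hq g.
have [] := @diagonal_aut (phi \o Phi q g').
- by apply: is_coalg_aut_comp => //; apply: Phi_aut.
- move=> c; rewrite (dual_comp hq _ _ phiL).
  have g'E := (Phi_conj hq g').2 (dual phi (munit c 0)).
  rewrite -[LHS]imul1 -WW -imulA g'E imulA Wg uF -imulA -Wg WW.
  exact: imulr1.
move=> alpha alpha0 phiE; exists g, alpha; split; first exact: alpha0.
apply: functional_extensionality => v.
have g'gv : Phi q g' (Phi q g v) = v by apply: (congr1 (@^~ v) g'g).
apply: etrans (congr1 phi (esym g'gv)) _.
exact: (congr1 (@^~ (Phi q g v)) phiE).
Qed.

(** After the translation is undone, a rescaling times some [Phi q g] remains; [Phi_act] moves the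
    rescaling to the right, replacing [g] by [act b g]. *)
Lemma coalg_aut_decomp phi : is_coalg_aut q phi ->
  exists (g : Ginf k) a, unit_seq a.1 /\ Phi q g \o tau a = phi.
Proof.
move=> H; have [r phi_x] := grouplike_shift H.
pose s r : (int -> k) * int := (fun _ => 1, r).
have s0 r' : unit_seq (s r').1 by move=> n; apply: oner_neq0.
have [] := @unipotent_diagonal (phi \o tau (s (- r))).
- by apply: is_coalg_aut_comp => //; apply: tau_aut.
- by move=> n; rewrite /= tau_mon bprod1 scale1r phi_x subrK.
move=> g [alpha [alpha0 psiE]]; pose b := (alpha, 0 : int).
exists (act b g), (sd_mul b (s r)); split=> [n|].
  by rewrite mulf_neq0 ?alpha0 ?oner_neq0.
have tauVK : tau (s (- r)) \o tau (s r) = id.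
  rewrite -(tau_comp hq) -(tau_id hq); congr tau; rewrite /sd_mul /= addNr.
  by congr (_, _); apply: functional_extensionality => n; rewrite mulr1.
apply: functional_extensionality => v.
apply: etrans (congr1 (fun f => Phi q (act b g) (f v)) (tau_comp hq b (s r))) _.
apply: etrans (congr1 (@^~ (tau (s r) v)) (Phi_act hq g (alpha0 : unit_seq b.1))) _.
apply: etrans (congr1 (@^~ (tau (s r) v)) (esym psiE)) _.
exact: (congr1 (fun f => phi (f v)) tauVK).
Qed.

End Classification.

(** * The semidirect product decompositions *)

Section SemidirectProducts.
Set Implicit Arguments.
Unset Strict Implicit.
Variables (k : fieldType) (q : k).
Hypothesis hq : forall n : nat, (0 < n)%N -> q ^+ n != 1.
Implicit Types (g h : Ginf k) (a b : (int -> k) * int) (phi : Hsp k -> Hsp k).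
Local Notation W g := (wprod (Gcoef q g)).

Lemma Psi_tau g a : Psi q g a = Phi q g \o tau a.
Proof. by []. Qed.

Lemma Psi0E g alpha : Psi0 q g alpha = Psi q g (alpha, 0).
Proof.
have theta0 : theta k 0 = id.
  apply: linear_malg_ext => //; first exact: lin_ext_linear.
  by move=> [n m]; rewrite /theta lin_ext_mon addr0.
by rewrite /Psi /= theta0.
Qed.

Lemma Psi_mon0 g a n : Psi q g a (mon k n 0) = mon k (n + a.2) 0.
Proof. by rewrite Psi_tau /= tau_mon /bprod big_ord0 scale1r Phi_mon0. Qed.

Lemma coef_mon1 n (beta : k) :
  (mon k n 1 + beta *: (mon k (n + 1) 0 - mon k n 0))@_(n, 1%N) = 1.
Proof.
rewrite mcoeffD mcoeffZ mcoeffB !mcoeff_mon /munit !andbF eqxx.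
by rewrite subrr mulr0 addr0.
Qed.

(** [Phi q g] changes x^n y only by group-likes, so the rescaling can be read off in degree 1. *)
Lemma coef_Psi g a n : (Psi q g a (mon k n 1))@_(n + a.2, 1%N) = a.1 (n + a.2).
Proof.
rewrite Psi_tau /= tau_mon (linearZ_fun _ _ (Phi_linear q g)) mcoeffZ Phi_mon1.
by rewrite coef_mon1 mulr1 /bprod big_ord1 addr0.
Qed.

(** The translation is read off from the image of 1 and the rescaling from [coef_Psi]; then [tau a]
    cancels. *)
Lemma Psi_inj g g' a a' : unit_seq a.1 -> Psi q g a = Psi q g' a' -> g = g' /\ a = a'.
Proof.
move=> a0 eqPsi; have eq2 : a.2 = a'.2.
  have := congr1 (@^~ (mon k 0 0)) eqPsi; rewrite /= !Psi_mon0 !add0r.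
  by case/mon_inj.
have eq1 : a.1 = a'.1.
  apply: functional_extensionality => n; rewrite -(subrK a.2 n) -(coef_Psi g).
  by rewrite eqPsi eq2 coef_Psi.
have eq_a : a = a' by case: a a' eq1 eq2 {a0 eqPsi} => [? ?] [? ?] /= -> ->.
split; last exact: eq_a.
apply: (Phi_inj hq); apply: functional_extensionality => v.
rewrite -eq_a in eqPsi; have tv : tau a (tau (sd_inv a) v) = v.
  exact: (congr1 (@^~ v) (tauK hq a0)).
apply: etrans (congr1 (Phi q g) (esym tv)) _.
apply: etrans (congr1 (@^~ (tau (sd_inv a) v)) eqPsi) _.
exact: (congr1 (Phi q g') tv).
Qed.

Lemma Psi_aut g a : unit_seq a.1 -> is_coalg_aut q (Psi q g a).
Proof. by move=> a0; apply: is_coalg_aut_comp (Phi_aut hq g) (tau_aut hq a0). Qed.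

Lemma Psi_mul g g' gg a a' : unit_seq a.1 ->
  Phi q gg = Phi q g \o Phi q (act a g') ->
  Psi q gg (sd_mul a a') = Psi q g a \o Psi q g' a'.
Proof.
move=> a0 eq_gg; apply: functional_extensionality => v.
apply: etrans (congr1 (fun f => Phi q gg (f v)) (tau_comp hq a a')) _.
apply: etrans (congr1 (@^~ (tau a (tau a' v))) eq_gg) _.
exact: (congr1 (fun f => Phi q g (f (tau a' v))) (Phi_act hq g' a0)).
Qed.

Lemma Phi_aut_star g : is_aut_star q (Phi q g).
Proof.
split; first by split; [apply: Phi_aut | apply: Phi_mon0].
by move=> n; exists (g 0%N n); apply: Phi_mon1.
Qed.

(** Fixing 1 forces the translation to be trivial. *)
Lemma aut0_decomp phi : is_aut0 q phi ->
  exists g alpha, unit_seq alpha /\ Psi q g (alpha, 0) = phi.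
Proof.
move=> [/(coalg_aut_decomp hq)[g [[alpha r] [alpha0 phiE]]] phi1].
exists g, alpha; split; first exact: alpha0.
rewrite -Psi_tau in phiE; move: phi1; rewrite -phiE Psi_mon0 add0r /=.
by case/mon_inj=> -> _.
Qed.

(** The coefficient 1 of x^n y in its image forces the rescaling to be trivial. *)
Lemma Phi_surj phi : is_aut_star q phi -> exists g, Phi q g = phi.
Proof.
move=> [/aut0_decomp[g [alpha [_ phiE]]] phi_y]; exists g.
have alpha1 : alpha = fun _ => 1.
  apply: functional_extensionality => n; have [beta phin] := phi_y n.
  have := coef_Psi g (alpha, 0) n; rewrite phiE phin /= addr0 coef_mon1.
  by move=> <-.
rewrite -phiE alpha1; apply: esym.
exact: (congr1 (fun f => Phi q g \o f) (tau_id hq)).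
Qed.

Lemma Phi_mul g h : exists gh, Phi q gh = Phi q g \o Phi q h.
Proof.
have [gh Wgh] := W_surj hq (unitri_mul (unitri_W q g) (unitri_W q h)).
exists gh; apply: (conj_by_Phi hq Wgh).
exact: conj_by_comp (Phi_conj hq g) (Phi_conj hq h).
Qed.

Lemma Phi_one : exists e, Phi q e = id.
Proof.
have [e We] := W_surj hq (fun _ => erefl : ione k _ 0%N = 1).
by exists e; apply: (conj_by_Phi hq We (conj_by_id hq)).
Qed.

(** On the maps, [act a] is conjugation by [tau a], hence multiplicative. *)
Lemma Phi_act_mul a g h gh : unit_seq a.1 ->
  Phi q gh = Phi q g \o Phi q h ->
  Phi q (act a gh) = Phi q (act a g) \o Phi q (act a h).
Proof.
move=> a0 eq_gh; apply: functional_extensionality => v.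
have tv : tau a (tau (sd_inv a) v) = v by apply: (congr1 (@^~ v) (tauK hq a0)).
(* As [tau a] is onto, it suffices to compare values at [tau a w]. *)
move: (tau (sd_inv a) v) tv => w <- {v}.
have actE g1 u : Phi q (act a g1) (tau a u) = tau a (Phi q g1 u).
  exact: (congr1 (@^~ u) (Phi_act hq g1 a0)).
apply: etrans (actE gh w) _.
apply: etrans (congr1 (fun f => tau a (f w)) eq_gh) _.
apply: etrans (esym (actE g (Phi q h w))) _.
exact: (congr1 (Phi q (act a g)) (esym (actE h w))).
Qed.

End SemidirectProducts.

Theorem theorem3p17 (k : fieldType) (q : k) (hq0 : q != 0)
    (hq : forall n : nat, (0 < n)%N -> q ^+ n != 1) :
  (* Phi is a bijection G_infty -> Aut_*(H) *)
  [/\ (forall g : Ginf k, is_aut_star q (Phi q g)),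
      (forall g h : Ginf k, Phi q g = Phi q h -> g = h)
    & (forall phi : Hsp k -> Hsp k, is_aut_star q phi -> exists g : Ginf k, Phi q g = phi)] /\
  (* Aut_*(H) is a group, so the group structure can be transported along Phi *)
  [/\ (forall g h : Ginf k, exists gh : Ginf k, Phi q gh = Phi q g \o Phi q h),
      (exists e : Ginf k, Phi q e = id)
    & (forall g : Ginf k, exists g' : Ginf k, Phi q g' \o Phi q g = id)] /\
  (* an action of (k^x)^Z x| Z on G_infty by group automorphisms *)
  [/\ (forall g : Ginf k, act ((fun _ => 1 : k), 0) g = g),
      (forall (a b : (int -> k) * int) (g : Ginf k), unit_seq a.1 -> unit_seq b.1 ->
          act (sd_mul a b) g = act a (act b g)),
      (forall a : (int -> k) * int, unit_seq a.1 -> bijective (act a))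
    & (forall (a : (int -> k) * int) (g h gh : Ginf k), unit_seq a.1 ->
          Phi q gh = Phi q g \o Phi q h ->
          Phi q (act a gh) = Phi q (act a g) \o Phi q (act a h))] /\
  (* G_infty x| ((k^x)^Z x| Z) -> Aut_c(H) is a group isomorphism *)
  [/\ (forall (g : Ginf k) (a : (int -> k) * int), unit_seq a.1 -> is_coalg_aut q (Psi q g a)),
      (forall (g g' : Ginf k) (a a' : (int -> k) * int), unit_seq a.1 -> unit_seq a'.1 ->
          Psi q g a = Psi q g' a' -> g = g' /\ a = a'),
      (forall phi : Hsp k -> Hsp k, is_coalg_aut q phi ->
          exists (g : Ginf k) (a : (int -> k) * int), unit_seq a.1 /\ Psi q g a = phi)
    & (forall (g g' gg : Ginf k) (a a' : (int -> k) * int), unit_seq a.1 -> unit_seq a'.1 ->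
          Phi q gg = Phi q g \o Phi q (act a g') ->
          Psi q gg (sd_mul a a') = Psi q g a \o Psi q g' a')] /\
  (* G_infty x| (k^x)^Z -> Aut_0(H) is a group isomorphism *)
  [/\ (forall (g : Ginf k) (alpha : int -> k), unit_seq alpha -> is_aut0 q (Psi0 q g alpha)),
      (forall (g g' : Ginf k) (alpha alpha' : int -> k), unit_seq alpha -> unit_seq alpha' ->
          Psi0 q g alpha = Psi0 q g' alpha' -> g = g' /\ alpha = alpha'),
      (forall phi : Hsp k -> Hsp k, is_aut0 q phi ->
          exists (g : Ginf k) (alpha : int -> k), unit_seq alpha /\ Psi0 q g alpha = phi)
    & (forall (g g' gg : Ginf k) (alpha alpha' : int -> k), unit_seq alpha -> unit_seq alpha' ->
          Phi q gg = Phi q g \o Phi q (act (alpha, 0) g') ->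
          Psi0 q gg (fun n => alpha n * alpha' n) = Psi0 q g alpha \o Psi0 q g' alpha')].
Proof.
split; first by split; [apply: Phi_aut_star | apply: Phi_inj | apply: Phi_surj].
split.
  split; [exact: Phi_mul | exact: Phi_one |] => g.
  by have [g' [_ _ g'g]] := Phi_inv hq g; exists g'.
split.
  split; [exact: act1 | by move=> *; apply: actM | exact: act_bij |].
  by move=> a g h gh; apply: Phi_act_mul.
split.
  split; [exact: Psi_aut | | | ].
  - by move=> g g' a a' a0 _; apply: Psi_inj.
  - by move=> phi /(coalg_aut_decomp hq).
  - by move=> g g' gg a a' a0 _; apply: Psi_mul.
split.
- move=> g alpha alpha0; rewrite Psi0E; split; first exact: Psi_aut.
  exact: Psi_mon0.
- move=> g g' alpha alpha' alpha0 _; rewrite !Psi0E.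
  by case/(Psi_inj hq (alpha0 : unit_seq (alpha, 0).1)) => -> [->].
- move=> phi /(aut0_decomp hq)[g [alpha [alpha0 phiE]]].
  by exists g, alpha; split; [exact: alpha0 | rewrite Psi0E].
move=> g g' gg alpha alpha' alpha0 _ eq_gg; rewrite !Psi0E.
apply: etrans (Psi_mul hq (alpha', 0) (alpha0 : unit_seq (alpha, 0).1) eq_gg).
congr (Psi q gg _); rewrite /sd_mul /= addr0; congr (_, _).
by apply: functional_extensionality => n; rewrite subr0.
Qed.
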